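(* Let $E$ be an elliptic curve over $\overline{\mathbb{Q}}$ with a given Weierstrass equation. The set of $x$-coordinates of the torsion points of $E(\overline{\mathbb{Q}})$ does not contain arbitrarily long non-trivial arithmetic progressions, and the same holds for the set of $y$-coordinates of the torsion points. Moreover, a bound for the length of such progressions can be effectively computed from the $j$-invariant of $E$.
   Context: A non-trivial arithmetic progression in a field is a sequence $u_1,\dots,u_n$ with $u_j=a+jb$ for some $a,b$ in the field, $b\neq 0$. Torsion points are taken with finite coordinates (i.e. excluding the point at infinity). *)

(* Defs.v *)
From HB Require Import structures.
From mathcomp Require Import all_boot all_order all_algebra all_field.

Set Implicit Arguments.
Unset Strict Implicit.
Unset Printing Implicit Defensive.

Import Order.TTheory GRing.Theory Num.Theory.
Local Open Scope ring_scope.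

Section Weierstrass.

Variable F : fieldType.

(* y^2 + a1 x y + a3 y = x^3 + a2 x^2 + a4 x + a6 *)
Record weierstrass :=
  Weierstrass { coef1 : F; coef2 : F; coef3 : F; coef4 : F; coef6 : F }.

Inductive point := Inf | Aff of F & F.

Variable E : weierstrass.

Local Notation a1 := (coef1 E).
Local Notation a2 := (coef2 E).
Local Notation a3 := (coef3 E).
Local Notation a4 := (coef4 E).
Local Notation a6 := (coef6 E).

Definition b2 : F := a1 ^+ 2 + 4%:R * a2.
Definition b4 : F := 2%:R * a4 + a1 * a3.
Definition b6 : F := a3 ^+ 2 + 4%:R * a6.
Definition b8 : F :=
  a1 ^+ 2 * a6 + 4%:R * a2 * a6 - a1 * a3 * a4 + a2 * a3 ^+ 2 - a4 ^+ 2.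
Definition c4 : F := b2 ^+ 2 - 24%:R * b4.
Definition disc : F :=
  - (b2 ^+ 2 * b8) - 8%:R * b4 ^+ 3 - 27%:R * b6 ^+ 2 + 9%:R * b2 * b4 * b6.

Definition elliptic : Prop := disc != 0.

Definition j_invariant : F := c4 ^+ 3 / disc.

Definition on_curve (P : point) : Prop :=
  match P with
  | Inf => True
  | Aff x y =>
      y ^+ 2 + a1 * x * y + a3 * y = x ^+ 3 + a2 * x ^+ 2 + a4 * x + a6
  end.

(* Chord-tangent law (Silverman, The Arithmetic of Elliptic Curves, III.2.3);
   meaningful only for points satisfying on_curve. *)
Definition add_point (P Q : point) : point :=
  match P, Q with
  | Inf, _ => Q
  | _, Inf => P
  | Aff x1 y1, Aff x2 y2 =>
      if (x1 == x2) && (y1 + y2 + a1 * x2 + a3 == 0) then Inf else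
      let l := if x1 == x2
               then (3%:R * x1 ^+ 2 + 2%:R * a2 * x1 + a4 - a1 * y1)
                      / (2%:R * y1 + a1 * x1 + a3)
               else (y2 - y1) / (x2 - x1) in
      let x := l ^+ 2 + a1 * l - a2 - x1 - x2 in
      Aff x (- (l + a1) * x - (y1 - l * x1) - a3)
  end.

Definition mul_point (n : nat) (P : point) : point := iter n (add_point P) Inf.

Definition torsion_point (P : point) : Prop :=
  on_curve P /\ exists n : nat, (0 < n)%N /\ mul_point n P = Inf.

Definition torsion_x (x : F) : Prop := exists y : F, torsion_point (Aff x y).
Definition torsion_y (y : F) : Prop := exists x : F, torsion_point (Aff x y).

End Weierstrass.

Definition has_AP (F : fieldType) (X : F -> Prop) (n : nat) : Prop :=
  exists a b : F, b != 0 /\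
    forall j : nat, (1 <= j <= n)%N -> X (a + j%:R * b).

Definition arbitrarily_long_APs (F : fieldType) (X : F -> Prop) : Prop :=
  forall N : nat, exists n : nat, (N <= n)%N /\ has_AP X n.

(* The total recursive functions of several variables: the closure of the
   basic functions under composition, primitive recursion and minimization of
   regular functions.  By Kleene's normal form theorem these are exactly the
   total Turing-computable functions. *)
Inductive recursive : forall n : nat, (n.-tuple nat -> nat) -> Prop :=
| rec_zero n (h : n.-tuple nat -> nat) of (forall v, h v = 0%N) : recursive h
| rec_succ (h : 1.-tuple nat -> nat) of (forall v, h v = (thead v).+1) :
    recursive h
| rec_proj n (i : 'I_n) (h : n.-tuple nat -> nat)
    of (forall v, h v = tnth v i) : recursive h
| rec_comp m n (f : m.-tuple nat -> nat) (g : 'I_m -> n.-tuple nat -> nat)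
    (h : n.-tuple nat -> nat)
    of recursive f & (forall i, recursive (g i))
     & (forall v, h v = f [tuple g i v | i < m]) : recursive h
| rec_primrec n (f : n.-tuple nat -> nat) (g : n.+2.-tuple nat -> nat)
    (h : n.+1.-tuple nat -> nat)
    of recursive f & recursive g
     & (forall v, h (cons_tuple 0%N v) = f v)
     & (forall k v, h (cons_tuple k.+1 v) =
          g (cons_tuple k (cons_tuple (h (cons_tuple k v)) v))) : recursive h
| rec_min n (f : n.+1.-tuple nat -> nat) (h : n.-tuple nat -> nat)
    of recursive f
     & (forall v, f (cons_tuple (h v) v) = 0%N)
     & (forall v k, f (cons_tuple k v) = 0%N -> (h v <= k)%N) : recursive h.

Definition computable (B : nat -> nat) : Prop :=
  recursive (fun v : 1.-tuple nat => B (thead v)).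

(* 0, 1, 2, 3, 4, ... encode 0, -1, 1, -2, 2, ... *)
Definition int_of_code (k : nat) : int :=
  if odd k then Negz k./2 else Posz k./2.

(* The sequence d, a, b, c_0, ..., c_m describes z when z is the only root of
   the nonzero integer polynomial with coefficients c_0, ..., c_m lying in the
   open disk of center (a + b i) / d and radius 1 / d; a, b and the c_k are
   read through int_of_code.  Rounding shows that every algebraic number has
   such a description, for any annihilating polynomial and all large d. *)
Definition describes (s : seq nat) (z : algC) : Prop :=
  if s is [:: d, a, b & cs] then
    let p : {poly algC} := Poly [seq (int_of_code c)%:~R | c <- cs] in
    let center : algC :=
      ((int_of_code a)%:~R + (int_of_code b)%:~R * 'i) / d%:R in
    [/\ (0 < d)%N, p != 0, root p z, `|z - center| < d%:R^-1
      & forall w : algC, root p w -> `|w - center| < d%:R^-1 -> w = z]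
  else False.

(* CodeSeq.code is an effective bijection from finite sequences of natural
   numbers to natural numbers. *)
Definition is_code (c : nat) (z : algC) : Prop :=
  exists s : seq nat, describes s z /\ c = CodeSeq.code s.

(* Main.v *)
(* The argument is p-adic. Fix a prime p >= 5 at which j is integral, and a valuation ring V
   above p in the field of algebraic numbers. There is a model y^2 = x^3 + A x + B with A, B
   in V and 4 A^3 + 27 B^2 = 1. Near infinity the group law is z1 + z2 up to higher order
   terms in the parameter z = x / y, so that no torsion point near infinity, other than
   infinity itself, has z in pV. Two torsion points with very close but distinct abscissas
   would have their sum or their difference in that neighbourhood; hence p^2 / (x - x') is in
   V for distinct abscissas x, x' of torsion points. In an arithmetic progression, on the
   other hand, terms whose indices agree modulo a high power of p are p-adically very close.
   Both coordinates of the original equation are linear forms in (1, x, y), and prescribing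
   such a form on the curve leaves a cubic equation for x: seven terms with congruent indices
   give four distinct abscissas at which a single cubic with a unit among its top two
   coefficients is tiny, contradicting Lagrange interpolation. The length is thus less than 6
   p^15 + 1 for every p >= 5 prime to the leading coefficient of an integer polynomial with
   root j. The group law enters only through the fact that torsion points are closed under
   sums and opposites, which is read off from the ideal classes of the points in the
   coordinate ring. *)

Require Import Defs.
From HB Require Import structures.
From mathcomp Require Import all_boot all_order all_algebra all_field.
From mathcomp Require Import ring.
From mathcomp Require boolp classical_sets.

Set Implicit Arguments.
Unset Strict Implicit.
Unset Printing Implicit Defensive.

Import Order.TTheory GRing.Theory Num.Theory.
Local Open Scope ring_scope.

Ltac rpred_auto :=
  repeat match goal with
  | H : is_true (?x \in _) |- is_true (?x \in _) => exact: H
  | |- is_true (_%:R \in _) => exact: rpred_nat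
  | |- is_true (1 \in _) => exact: rpred1
  | |- is_true (0 \in _) => exact: rpred0
  | |- is_true (_ + _ \in _) => apply: rpredD
  | |- is_true (- _ \in _) => rewrite rpredN
  | |- is_true (_ ^+ _ \in _) => apply: rpredX
  | |- is_true (_ * _ \in _) => apply: rpredM
  end.

(** * Valuation rings *)

(** Linear combination with one hypothesis: [k] is the cofactor, and what remains is an identity for
    [ring] or [field]. *)
Lemma eq_of_subM (R : pzRingType) (k u v a b : R) :
  u = v -> a - b = k * (u - v) -> a = b.
Proof. by move=> -> /eqP; rewrite subrr mulr0 subr_eq0 => /eqP. Qed.

Section ValuationRing.

Variables (F : numFieldType) (V : subringClosed F) (p : nat).
Hypothesis valV : forall x, (x \in V) || (x^-1 \in V).
Hypothesis pV : p%:R^-1 \notin V.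

Lemma val_sqrt x : x ^+ 2 \in V -> x \in V.
Proof.
move=> x2V; have [//|xiV] := orP (valV x).
have [->|x0] := eqVneq x 0; first by rewrite rpred0.
have -> : x = x ^+ 2 * x^-1 by field.
by rewrite rpredM.
Qed.

Lemma val_cubert x : x ^+ 3 \in V -> x \in V.
Proof.
move=> x3V; have [//|xiV] := orP (valV x).
have [->|x0] := eqVneq x 0; first by rewrite rpred0.
have -> : x = x ^+ 3 * x^-1 * x^-1 by field.
by rewrite rpredM // rpredM.
Qed.

Lemma char_neq0 : p%:R != 0 :> F.
Proof. by apply: contra pV => /eqP ->; rewrite invr0 rpred0. Qed.

Lemma principal_unit_neq0 e : e \in V -> 1 + p%:R * e != 0.
Proof.
move=> eV; apply: contra pV => /eqP u0.
have -> : p%:R^-1 = - e :> F.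
  apply: (mulfI char_neq0); rewrite mulfV ?char_neq0 //.
  by apply: (eq_of_subM (k := 1) u0); ring.
by rewrite rpredN.
Qed.

(** For [t = (1 + p e) / (p e)], having [t] in V would put [1/p = e (t - 1)] in V; hence [t^-1] is
    in V, and [1 - t^-1] is the inverse sought. *)
Lemma principal_unitV e : e \in V -> (1 + p%:R * e)^-1 \in V.
Proof.
move=> eV; have u0 := principal_unit_neq0 eV; have p0 := char_neq0.
have [->|e0] := eqVneq e 0; first by rewrite mulr0 addr0 invr1 rpred1.
have /orP[tV|tV] := valV ((1 + p%:R * e) / (p%:R * e)).
  case/negP: pV.
  have -> : p%:R^-1 = e * ((1 + p%:R * e) / (p%:R * e) - 1) :> F.
    by field; rewrite e0 p0.
  by rewrite rpredM // rpredB // rpred1.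
have -> : (1 + p%:R * e)^-1 = 1 - ((1 + p%:R * e) / (p%:R * e))^-1.
  by field; rewrite u0 e0 p0.
by rewrite rpredB // rpred1.
Qed.

(** Valuation rings are local: comparing [a] with [b] gives [1/b = a/b + 1] or [1/a = b/a + 1]
    inside V. *)
Lemma val_local a b : a \in V -> b \in V -> a + b = 1 ->
  (a != 0) && (a^-1 \in V) \/ (b != 0) && (b^-1 \in V).
Proof.
move=> aV bV ab1.
have [a0|a0] := eqVneq a 0.
  by right; move: ab1; rewrite a0 add0r => ->; rewrite oner_neq0 invr1 rpred1.
have [b0|b0] := eqVneq b 0.
  by left; move: ab1; rewrite b0 addr0 => ->; rewrite invr1 rpred1.
have /orP[tV|tV] := valV (a / b); [right|left]; rewrite /=.
  have -> : b^-1 = a / b + 1 by apply: (eq_of_subM (k := - b^-1) ab1); field.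
  by rewrite rpredD ?rpred1.
have -> : a^-1 = (a / b)^-1 + 1.
  by apply: (eq_of_subM (k := - a^-1) ab1); field; rewrite a0 b0.
by rewrite rpredD ?rpred1.
Qed.

Lemma coprime_invV N : (0 < N)%N -> coprime N p -> N%:R^-1 \in V.
Proof.
move=> N_gt0 coNp; case: (egcdnP p N_gt0) => u v uv _.
have {}uv : u%:R * N%:R = 1 + p%:R * v%:R :> F.
  by rewrite -natrM uv (eqP coNp) addn1 -natr1 natrM mulrC addrC.
have u0 : u%:R * N%:R != 0 :> F by rewrite uv principal_unit_neq0 ?rpred_nat.
have N0 : N%:R != 0 :> F by move: u0; rewrite mulf_eq0 => /norP[].
have -> : N%:R^-1 = u%:R * (1 + p%:R * v%:R)^-1 :> F.
  by rewrite -uv; move: u0; rewrite mulf_eq0 => /norP[u0 _]; field; rewrite u0 N0.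
by rewrite rpredM ?rpred_nat // principal_unitV ?rpred_nat.
Qed.

End ValuationRing.

(** * Maximal subrings avoiding 1/p are valuation rings *)

Section MaximalSubring.

Variables (F : numFieldType) (V : subringClosed F) (p : nat).
Hypothesis pV : p%:R^-1 \notin V.
Hypothesis maxV : forall x, x \notin V ->
  exists2 q : {poly F}, q \is a polyOver V & p%:R^-1 = q.[x].

(** Put [u = 1 + p b]. If [1/u] were outside V, [1/p] would be a polynomial in [1/u]. A power of [u]
    clears the denominators, and since that power is still 1 modulo p, [1/p] itself would fall into
    V. *)
Lemma max_principal_unitV b : b \in V -> (1 + p%:R * b)^-1 \in V.
Proof.
move=> bV; apply: contraT => /maxV[q /polyOverP qV].
set u := 1 + p%:R * b => qE; have p0 := char_neq0 pV.
have u0 : u != 0 by apply: (principal_unit_neq0 pV).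
have [e eV ue] : exists2 e, e \in V & u ^+ size q = 1 + p%:R * e.
  elim: (size q) => [|n [e eV ue]]; first by exists 0; rewrite ?rpred0 ?expr0 ?mulr0 ?addr0.
  by exists (b + e + p%:R * b * e); [rpred_auto|rewrite exprS ue /u; ring].
case/negP: pV.
have -> : p%:R^-1 = u ^+ size q * p%:R^-1 - e by rewrite ue; field.
rewrite rpredB // qE horner_coef mulr_sumr rpred_sum // => i _.
have -> : u ^+ size q = u ^+ (size q - i) * u ^+ i by rewrite -exprD subnK // ltnW.
rewrite mulrCA -mulrA -exprMn mulfV // expr1n mulr1 rpredM // rpredX //.
by rewrite /u; rpred_auto.
Qed.

Let poly_span x n z := exists q : {poly F},
  [/\ q \is a polyOver V, (size q <= n)%N & z = q.[x]].

Lemma poly_spanD x n y z : poly_span x n y -> poly_span x n z -> poly_span x n (y + z).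
Proof.
move=> [q [qV qn ->]] [r [rV rn ->]]; exists (q + r); split; rewrite ?rpredD ?hornerD //.
by rewrite (leq_trans (size_polyD _ _)) // geq_max qn rn.
Qed.

Lemma poly_span_mon x n c i : c \in V -> (i < n)%N -> poly_span x n (c * x ^+ i).
Proof.
move=> cV lt_in; exists (c *: 'X^i); split.
- by rewrite polyOverZ // rpredX // polyOverX.
- by rewrite (leq_trans (size_scale_leq _ _)) // size_polyXn.
- by rewrite hornerZ hornerXn.
Qed.

Lemma poly_span_sum x n m (G : nat -> F) :
  (forall i, (i < m)%N -> poly_span x n (G i)) -> poly_span x n (\sum_(i < m) G i).
Proof.
move=> sG; elim/big_ind: _ => [|y z|i _]; [|exact: poly_spanD|exact: sG].
by exists 0; rewrite rpred0 size_poly0 horner0.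
Qed.

(** Multiplied by [x^(n+1)], the expression of [1/p] in [x^-1] equates [(u / p) x^(n+1)], where
    [u = 1 - p r_0] is invertible in V, with lower powers of [x]. This removes the top power from
    the other expression. *)
Lemma poly_span_inv_reduce x m n : x != 0 ->
  poly_span x n.+2 p%:R^-1 -> poly_span x^-1 m.+1 p%:R^-1 -> (m <= n.+1)%N ->
  poly_span x n.+1 p%:R^-1.
Proof.
move=> x0 [q [/polyOverP qV qn qE]] [r [/polyOverP rV rm rE]] le_mn.
have p0 := char_neq0 pV.
have NrV : - r`_0 \in V by rewrite rpredN.
have uV := max_principal_unitV NrV; have u0 := principal_unit_neq0 pV NrV.
set u := 1 + _ in uV u0.
have xE : x ^+ n.+1 = \sum_(i < m) p%:R / u * r`_i.+1 * x ^+ (n - i).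
  have -> : x ^+ n.+1 = p%:R / u * ((p%:R^-1 - r`_0) * x ^+ n.+1)
    by rewrite /u; field; rewrite p0 u0.
  rewrite {1}rE (horner_coef_wide _ rm) big_ord_recl expr0 mulr1 addrC addKr mulr_suml mulr_sumr.
  apply: eq_bigr => i _.
  have -> : x ^+ n.+1 = x ^+ i.+1 * x ^+ (n - i).
    by rewrite -exprD addSn subnKC // -ltnS (leq_trans (ltn_ord i)).
  by rewrite lift0 exprVn mulrA -!mulrA mulKf ?expf_neq0.
rewrite {1}qE (horner_coef_wide _ qn) big_ord_recr /=; apply: poly_spanD.
  by apply: (poly_span_sum (G := fun i => q`_i * x ^+ i)) => i; apply: poly_span_mon.
rewrite xE mulr_sumr.
apply: (poly_span_sum (G := fun i => q`_n.+1 * (p%:R / u * r`_i.+1 * x ^+ (n - i)))) => i _.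
rewrite mulrA; apply: poly_span_mon; last by rewrite ltnS leq_subr.
by rpred_auto.
Qed.

(** Descent on the total length of two expressions of [1/p], one in [x] and one in [x^-1]: the
    shorter always shortens the longer, until [1/p] would be a constant of V. *)
Lemma maximal_valuation x : (x \in V) || (x^-1 \in V).
Proof.
apply: contraT; rewrite negb_or => /andP[xV x'V].
have [q qV qE] := maxV xV; have [r rV rE] := maxV x'V.
have : poly_span x (size q).+1 p%:R^-1 by exists q; split.
have : poly_span x^-1 (size r).+1 p%:R^-1 by exists r; split.
have x0 : x != 0 by apply: contraNneq xV => ->; rewrite rpred0.
move: (size r) (size q) => m n rm qn; have [s le_s] := ubnP (n + m)%N.
elim: s n m x x0 {xV x'V q r qV rV qE rE} rm qn le_s => // s IH n m x x0 rm qn le_s.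
wlog le_mn : n m x x0 rm qn le_s / (m <= n)%N.
  move=> wl; have [|/ltnW le_nm] := leqP m n; first exact: (wl n m x).
  by apply: (wl m n x^-1); rewrite ?invr_eq0 ?invrK // addnC.
case: n le_mn qn le_s => [_ [q [/polyOverP qV q1 qE]] _|n le_mn qn le_s].
  by case/negP: pV; rewrite qE (size1_polyC q1) hornerC.
apply: (IH n m x) => //; exact: (poly_span_inv_reduce x0 qn rm le_mn).
Qed.

End MaximalSubring.

(** * Existence of valuation rings by Zorn's lemma *)

Definition is_subring (R : pzRingType) (S : R -> Prop) :=
  [/\ S 1, forall x y, S x -> S y -> S (x - y) & forall x y, S x -> S y -> S (x * y)].

Lemma subringClosed_of (R : pzRingType) (S : R -> Prop) : is_subring S ->
  exists V : subringClosed R, forall x, (x \in V) <-> S x.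
Proof.
move=> [S1 SB SM].
have Vc : subring_closed (fun x => boolp.asbool (S x)).
  split; rewrite ?inE; first exact/boolp.asboolP.
  - by move=> x y /boolp.asboolP Sx /boolp.asboolP Sy; apply/boolp.asboolP; apply: SB.
  - by move=> x y /boolp.asboolP Sx /boolp.asboolP Sy; apply/boolp.asboolP; apply: SM.
pose V := HB.pack_for (subringClosed R) (fun x => boolp.asbool (S x))
  (GRing.isSubringClosed.Build R _ Vc).
by exists V => x; split=> /boolp.asboolP.
Qed.

Lemma maximal_subring_exists (R : pzRingType) (S0 : R -> Prop) (c : R) :
  is_subring S0 -> ~ S0 c ->
  exists V : subringClosed R, [/\ forall x, S0 x -> x \in V, c \notin V &
    forall S, is_subring S -> (forall x, x \in V -> S x) -> ~ S c ->
      forall x, S x -> x \in V].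
Proof.
move=> ring0 c0.
(* The conditions bear on the union with [S0], so that the empty chain, whose union is empty,
   satisfies them too. *)
pose P (S : classical_sets.set R) :=
  is_subring (fun x => S x \/ S0 x) /\ ~ (S c \/ S0 c).
have [|S [[ringS cS] maxS]] := @classical_sets.Zorn_bigcup R P.
  move=> G GP totG; split.
    pose U x := classical_sets.bigcup G id x \/ S0 x; rewrite -/U.
    have pair x y : U x -> U y -> S0 x /\ S0 y \/
        exists2 S, G S & (S x \/ S0 x) /\ (S y \/ S0 y).
      move=> [[S GS Sx]|S0x] [[T GT Ty]|S0y]; last by left.
      - case: (totG S T GS GT) => [/(_ _ Sx) Tx|/(_ _ Ty) Sy]; right.
          by exists T => //; split; left.
        by exists S => //; split; left.
      - by right; exists S => //; split; [left|right].
      - by right; exists T => //; split; [right|left].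
    have sub S x : G S -> S x \/ S0 x -> U x by move=> GS [Sx|]; [left; exists S|right].
    have [S01 S0B S0M] := ring0; split; first by right.
      move=> x y Ux Uy; have [[Sx Sy]|[S GS [Sx Sy]]] := pair x y Ux Uy.
        by right; apply: S0B.
      by apply: (sub S) => //; have [[_ SB _] _] := GP S GS; apply: SB.
    move=> x y Ux Uy; have [[Sx Sy]|[S GS [Sx Sy]]] := pair x y Ux Uy.
      by right; apply: S0M.
    by apply: (sub S) => //; have [[_ _ SM] _] := GP S GS; apply: SM.
  by case=> [[S GS Sc]|//]; case: (GP _ GS) => _; apply; left.
have [V VE] := subringClosed_of ringS; exists V; split.
- by move=> x S0x; apply/VE; right.
- by apply/negP => /VE.
- move=> T ringT VT Tc x Tx; apply/VE; apply: boolp.contrapT => Sx.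
  case: (maxS T) => //; first split.
  - by move=> y Sy; apply: VT; apply/VE; left.
  - by move=> TS; apply: Sx; left; apply: TS.
  have S0T y : S0 y -> T y by move=> S0y; apply: VT; apply/VE; right.
  split; last by case=> [//|/S0T].
  suff -> : (fun y => T y \/ S0 y) = T by [].
  by apply: boolp.funext => y; apply: boolp.propext; split=> [[//|/S0T]|]; [|left].
Qed.

(** The integers avoid [1/p], so Zorn gives a maximal subring avoiding it. Maximality against [V[x]]
    is the hypothesis of [maximal_valuation]. *)
Lemma valuation_ring_exists (F : numFieldType) (p : nat) : prime p ->
  exists V : subringClosed F, (forall x, (x \in V) || (x^-1 \in V)) /\ p%:R^-1 \notin V.
Proof.
move=> p_pr; pose S0 (z : F) := exists m : int, z = m%:~R.
have ring0 : is_subring S0.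
  split; first by exists 1.
    by move=> _ _ [m ->] [n ->]; exists (m - n); rewrite intrB.
  by move=> _ _ [m ->] [n ->]; exists (m * n); rewrite intrM.
have p_notin : ~ S0 p%:R^-1.
  move=> [m mE]; have := prime_gt1 p_pr; have : p%:Z * m = 1.
    apply: (intr_inj (R := F)).
    by rewrite intrM -mE -pmulrn mulfV // pnatr_eq0 -lt0n prime_gt0.
  by move/(congr1 absz); rewrite abszM => /eqP; rewrite muln_eq1 => /andP[/eqP /= ->].
have [V [_ pV maxV]] := maximal_subring_exists ring0 p_notin.
exists V; split=> //.
apply: (maximal_valuation pV) => x xV; apply: boolp.contrapT => no_q.
case/negP: xV; apply: (maxV (fun z => exists2 q : {poly F}, q \is a polyOver V & z = q.[x])).
- split; first by exists 1; rewrite ?rpred1 ?hornerE.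
    by move=> _ _ [q qV ->] [r rV ->]; exists (q - r); rewrite ?rpredB ?hornerE.
  by move=> _ _ [q qV ->] [r rV ->]; exists (q * r); rewrite ?rpredM ?hornerE.
- by move=> y yV; exists y%:P; rewrite ?polyOverC ?hornerC.
- by move=> [q qV qE]; apply: no_q; exists q.
- by exists 'X; rewrite ?polyOverX ?hornerX.
Qed.

(** If [z] is outside V, then [z^-1] is inside. The leading coefficient is a unit of V, so dividing
    the equation by a power of [z] writes [z] as a polynomial in [z^-1] over V. *)
Lemma int_root_val (F : numFieldType) (V : subringClosed F) (p : nat) (q : {poly int}) (z : F) :
  (forall x, (x \in V) || (x^-1 \in V)) -> p%:R^-1 \notin V -> prime p ->
  ~~ (p %| `|lead_coef q|)%N -> root (map_poly intr q) z -> z \in V.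
Proof.
move=> valV pV p_pr pNl qz; have [//|z'V] := orP (valV z).
have [->|z0] := eqVneq z 0; first exact: rpred0.
have l0 : lead_coef q != 0 by apply: contraNneq pNl => ->; rewrite dvdn0.
have lV : (lead_coef q)%:~R^-1 \in V.
  rewrite [lead_coef q]intEsign intrM rmorph_sign invfM rpredM //.
    by rewrite -exprVn invrN1 rpredX // rpredN1.
  by apply: (coprime_invV valV pV); rewrite ?absz_gt0 // coprime_sym prime_coprime.
have l0' : (lead_coef q)%:~R != 0 :> F by rewrite intr_eq0.
move: qz; rewrite /root horner_coef size_map_poly_id0 //.
rewrite lead_coefE in l0 l0' lV; case sq: (size q) l0 l0' lV => [|[|n]] /= l0 l0' lV.
- by move: l0; rewrite nth_default ?sq.
- by rewrite big_ord_recl big_ord0 expr0 mulr1 addr0 coef_map /= (negPf l0').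
rewrite big_ord_recr /= coef_map /= addrC addr_eq0 => /eqP lz.
have -> : z = - ((q`_n.+1)%:~R^-1 * \sum_(i < n.+1) (map_poly intr q)`_i * (z^-1) ^+ (n - i)).
  apply: (mulIf (expf_neq0 n z0)); rewrite -exprS.
  rewrite mulNr -mulrA mulr_suml; apply: (mulfI l0'); rewrite lz mulrN mulVKf //.
  congr (- _); apply: eq_bigr => i _; rewrite -mulrA; congr (_ * _).
  have -> : z ^+ n = z ^+ (n - i) * z ^+ i by rewrite -exprD subnK // -ltnS.
  by rewrite exprVn mulKf ?expf_neq0.
rewrite rpredN rpredM // rpred_sum // => i _.
by rewrite coef_map /= rpredM ?rpred_int // rpredX.
Qed.

(** * The group law and ideal classes *)

Section IdealClasses.

Variable R : comNzRingType.
Implicit Types (I J K : R -> Prop) (a b c d f g : R).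

Lemma eq_pred I J : (forall f, I f <-> J f) -> I = J.
Proof. by move=> IJ; apply: boolp.funext => f; apply: boolp.propext. Qed.

Definition is_ideal I := [/\ I 0, forall f g, I f -> I g -> I (f + g)
  & forall a f, I f -> I (a * f)].

Inductive idmul I J : R -> Prop :=
| idmul0 : idmul I J 0
| idmulD a b f of I a & J b & idmul I J f : idmul I J (a * b + f).

Definition scale a I f := exists2 g, I g & f = a * g.

Definition unit_ideal : R -> Prop := fun=> True.

Lemma idmul1 I J a b : I a -> J b -> idmul I J (a * b).
Proof. by move=> Ia Jb; rewrite -[a * b]addr0; apply: idmulD => //; apply: idmul0. Qed.

Lemma idmul_add I J f g : idmul I J f -> idmul I J g -> idmul I J (f + g).
Proof.
elim=> [|a b h Ia Jb _ IH] Kg; first by rewrite add0r.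
by rewrite -addrA; apply: idmulD => //; apply: IH.
Qed.

Lemma idmulC I J : idmul I J = idmul J I.
Proof.
suff sub I' J' f : idmul I' J' f -> idmul J' I' f by apply: eq_pred => f; split; apply: sub.
by elim=> [|a b g Ia Jb _ IH]; [apply: idmul0 | rewrite mulrC; apply: idmulD].
Qed.

Lemma idmul_subA I J K f : idmul (idmul I J) K f -> idmul I (idmul J K) f.
Proof.
elim=> [|a b g Ia Kb _ IH]; first exact: idmul0.
apply: idmul_add => // {IH}.
elim: Ia => [|c d h Ic Jd _ IH]; first by rewrite mul0r; apply: idmul0.
rewrite mulrDl -mulrA; apply: idmulD => //; exact: idmul1.
Qed.

Lemma idmulA I J K : idmul I (idmul J K) = idmul (idmul I J) K.
Proof.
apply: eq_pred => f; split; last exact: idmul_subA.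
rewrite idmulC (idmulC J) => /idmul_subA.
by rewrite idmulC (idmulC J).
Qed.

Lemma idmulACA I J K L : 
  idmul (idmul I J) (idmul K L) = idmul (idmul I K) (idmul J L).
Proof. by rewrite -!idmulA (idmulA J) (idmulC J) -(idmulA K). Qed.

Lemma idmul_ideal I J : is_ideal I -> is_ideal (idmul I J).
Proof.
case=> I0 ID IM; split; [exact: idmul0|exact: idmul_add|].
move=> a f; elim=> [|b c g Ib Jc _ IH]; first by rewrite mulr0; apply: idmul0.
by rewrite mulrDr mulrA; apply: idmulD => //; apply: (IM).
Qed.

Lemma idmul_unit I : is_ideal I -> idmul unit_ideal I = I.
Proof.
case=> I0 ID IM; apply: eq_pred => f; split.
  by elim=> // a b g _ Ib _ Ig; apply: ID => //; apply: (IM).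
by move=> If; rewrite -[f]mul1r; apply: idmul1.
Qed.

Lemma unit_ideal_ideal : is_ideal unit_ideal. Proof. by []. Qed.

Lemma scaleA a b I : scale a (scale b I) = scale (a * b) I.
Proof.
apply: eq_pred => f; split=> [[_ [g Ig ->] ->]|[g Ig ->]].
  by exists g; rewrite ?mulrA.
by exists (b * g); [exists g|rewrite mulrA].
Qed.

Lemma idmul_scaler a I J : idmul I (scale a J) = scale a (idmul I J).
Proof.
apply: eq_pred => f; split.
  elim=> [|b _ g Ib [c Jc ->] _ [h Kh ->]].
    by exists 0; [exact: idmul0|rewrite mulr0].
  by exists (b * c + h); [exact: idmulD|ring].
case=> h + ->; elim=> [|b c g Ib Jc _ IH]; first by rewrite mulr0; apply: idmul0.
by rewrite mulrDr mulrCA; apply: idmulD => //; exists c.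
Qed.

Lemma idmul_scale a b I J : idmul (scale a I) (scale b J) = scale (a * b) (idmul I J).
Proof. by rewrite idmul_scaler idmulC idmul_scaler idmulC scaleA mulrC. Qed.

(** Equality of ideal classes without a fraction field: the multipliers are non-zero-divisors of the
    ring itself. *)
Definition ideal_sim I J :=
  exists a b, [/\ GRing.lreg a, GRing.lreg b & scale a I = scale b J].

Lemma sim_refl I : ideal_sim I I.
Proof. by exists 1, 1; split=> //; exact: lreg1. Qed.

Lemma sim_sym I J : ideal_sim I J -> ideal_sim J I.
Proof. by case=> a [b [? ? ?]]; exists b, a. Qed.

Lemma sim_trans J I K : ideal_sim I J -> ideal_sim J K -> ideal_sim I K.
Proof.
move=> [a [b [ra rb eqIJ]]] [c [d [rc rd eqJK]]].
exists (c * a), (b * d); split; [exact: lregM|exact: lregM|].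
by rewrite -scaleA eqIJ scaleA mulrC -!scaleA eqJK.
Qed.

Lemma sim_mul I J K L :
  ideal_sim I J -> ideal_sim K L -> ideal_sim (idmul I K) (idmul J L).
Proof.
move=> [a [b [ra rb eqIJ]]] [c [d [rc rd eqKL]]].
exists (a * c), (b * d); split; [exact: lregM|exact: lregM|].
by rewrite -!idmul_scale eqIJ eqKL.
Qed.

Definition idexp I n := iter n (idmul I) unit_ideal.

Lemma idexp_ideal I n : is_ideal I -> is_ideal (idexp I n).
Proof. by case: n => [|n] idI; [exact: unit_ideal_ideal|exact: idmul_ideal]. Qed.

Lemma idexpD I m n : is_ideal I -> idexp I (m + n) = idmul (idexp I m) (idexp I n).
Proof.
move=> idI; elim: m => [|m IH]; first by rewrite idmul_unit //; apply: idexp_ideal.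
by rewrite addSn /= -idmulA -IH.
Qed.

Lemma idexpM I m n : is_ideal I -> idexp I (m * n) = idexp (idexp I m) n.
Proof.
move=> idI; elim: n => [|n IH]; first by rewrite muln0.
by rewrite mulnS idexpD // IH.
Qed.

Lemma idexp_mul I J n : idexp (idmul I J) n = idmul (idexp I n) (idexp J n).
Proof.
elim: n => [|n IH] /=; last by rewrite IH idmulACA.
by rewrite idmul_unit //; exact: unit_ideal_ideal.
Qed.

Lemma sim_exp I J n : ideal_sim I J -> ideal_sim (idexp I n) (idexp J n).
Proof. by move=> IJ; elim: n => [|n IH]; [exact: sim_refl|exact: sim_mul]. Qed.

Lemma idexp_unit n : idexp unit_ideal n = unit_ideal.
Proof. by elim: n => //= n ->; rewrite idmul_unit //; exact: unit_ideal_ideal. Qed.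

Definition ideal2 a b f := exists s t, f = a * s + b * t.

Lemma ideal2_ideal a b : is_ideal (ideal2 a b).
Proof.
split; first by exists 0, 0; ring.
- by move=> _ _ [s [t ->]] [s' [t' ->]]; exists (s + s'), (t + t'); ring.
- by move=> c _ [s [t ->]]; exists (c * s), (c * t); ring.
Qed.

Lemma idmul_ideal2 a b c d f :
  idmul (ideal2 a b) (ideal2 c d) f <->
  exists s t u v, f = a * c * s + a * d * t + b * c * u + b * d * v.
Proof.
split.
  elim=> [|_ _ g [s [t ->]] [s' [t' ->]] _ [u1 [u2 [u3 [u4 ->]]]]].
    by exists 0, 0, 0, 0; ring.
  by exists (s * s' + u1), (s * t' + u2), (t * s' + u3), (t * t' + u4); ring.
move=> [s [t [u [v ->]]]].
have [Ia Ib Jc Jd] : [/\ ideal2 a b a, ideal2 a b b, ideal2 c d c & ideal2 c d d].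
  by split; [exists 1, 0|exists 0, 1|exists 1, 0|exists 0, 1]; ring.
have [_ IA IM] := @idmul_ideal _ (ideal2 c d) (ideal2_ideal a b).
have -> : a * c * s + a * d * t + b * c * u + b * d * v =
  s * (a * c) + t * (a * d) + u * (b * c) + v * (b * d) by ring.
by apply: (IA); [apply: (IA); [apply: (IA)|]|]; apply: (IM); apply: idmul1.
Qed.

(** All four products of generators are divisible by [X - x]. Conversely [2 y (X - x)] and
    [d (X - x)] are combinations of them, and smoothness of the point makes [2 y] or [d]
    invertible. *)
Lemma opp_ideal (X Y x y r d i : R) :
  (Y - y) * (Y + y) = (X - x) * ((X - x) * r + d) ->
  2%:R * y * i = 1 \/ d * i = 1 ->
  idmul (ideal2 (X - x) (Y - y)) (ideal2 (X - x) (Y + y)) = scale (X - x) unit_ideal.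
Proof.
move=> K yd; apply: eq_pred => f; split.
  case/idmul_ideal2 => s [t [u [v ->]]].
  exists ((X - x) * s + (Y + y) * t + (Y - y) * u + ((X - x) * r + d) * v) => //.
  by apply: (eq_of_subM (k := v) K); ring.
case=> g _ ->; apply/idmul_ideal2; case: yd => [yi|di].
  exists 0, (i * g), (- (i * g)), 0.
  by apply: (eq_of_subM (k := - ((X - x) * g)) yi); ring.
exists (- (r * i * g)), 0, 0, (i * g).
have -> : (X - x) * g = (X - x) * (d * i) * g by rewrite di mulr1.
by apply: (eq_of_subM (k := - (i * g)) K); ring.
Qed.

(* [Y - l X - k] is the line through the two points and [x3] the abscissa of its third
   intersection; the last hypothesis says that the ideals of the points, taken modulo the
   conjugate line, are comaximal. *)
Lemma chord_ideal (X Y x1 y1 x2 y2 x3 l k i : R) :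
  y1 = l * x1 + k -> y2 = l * x2 + k ->
  (X - x1) * (X - x2) * (X - x3) = Y ^+ 2 - (l * X + k) ^+ 2 ->
  (x1 - x2) * i = 1 \/ x1 = x2 /\ 2%:R * y1 * i = 1 ->
  scale (X - x3) (idmul (ideal2 (X - x1) (Y - y1)) (ideal2 (X - x2) (Y - y2))) =
  scale (Y - (l * X + k)) (ideal2 (X - x3) (Y + (l * x3 + k))).
Proof.
move=> -> -> K xi; apply: eq_pred => f; split.
  case=> g /idmul_ideal2 [s [t [u [v ->]]]] ->.
  pose L := Y - (l * X + k).
  exists ((X - x3) * (l * (s + l * t + l * u + l ^+ 2 * v) + (X - x1) * t 
     + (X - x2) * u + (L + l * (X - x1) + l * (X - x2)) * v) 
     + (Y + (l * x3 + k)) * (s + l * t + l * u + l ^+ 2 * v)).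
    by do 2!eexists; reflexivity.
  apply: (eq_of_subM (k := s + l * t + l * u + l ^+ 2 * v) K).
  by rewrite /L; ring.
case=> g [s [t ->]] ->.
have K' : (Y - (l * X + k)) * (Y + (l * x3 + k)) = 
   (X - x3) * ((X - x1) * (X - x2) - l * (Y - (l * X + k))).
  by apply: (eq_of_subM (k := - 1) K); ring.
have [_ IA IM] := @idmul_ideal _ (ideal2 (X - x2) (Y - (l * x2 + k)))
  (ideal2_ideal (X - x1) (Y - (l * x1 + k))).
set I := idmul _ _ in IA IM *.
have IN a b : I a -> I b -> I (a - b).
  by move=> Ia Ib; apply: (IA) => //; rewrite -mulN1r; apply: (IM).
have mem s' t' u' v' : I ((X - x1) * (X - x2) * s' + (X - x1) * (Y - (l * x2 + k)) * t'
   + (Y - (l * x1 + k)) * (X - x2) * u' + (Y - (l * x1 + k)) * (Y - (l * x2 + k)) * v').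
  by apply/idmul_ideal2; do 4!eexists; reflexivity.
have I12 : I ((X - x1) * (X - x2)).
  by have := mem 1 0 0 0; congr I; ring.
have IL1 : I ((X - x1) * (Y - (l * X + k))).
  by have := IA _ _ (mem 0 1 0 0) (IM (- l) _ I12); congr I; ring.
have IL2 : I ((X - x2) * (Y - (l * X + k))).
  by have := IA _ _ (mem 0 0 1 0) (IM (- l) _ I12); congr I; ring.
have ILL : I ((Y - (l * X + k)) ^+ 2).
  have := IA _ _ (IA _ _ (mem 0 0 0 1) (IM (- l) _ IL1))
    (IA _ _ (IM (- l) _ IL2) (IM (- l ^+ 2) _ I12)).
  by congr I; ring.
pose L := Y - (l * X + k); pose M := Y + (l * X + k).
(* Morally [q] is [L]. Asking for equality only after multiplication by [X - x3] makes the equation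
   [K] of the chord available. *)
suff [q Iq qE] : exists2 q, I q & L * (X - x3) = (X - x3) * q.
  exists (s * q + t * ((X - x1) * (X - x2) - l * q)).
    by apply: (IA); apply: (IM) => //; apply: (IN) => //; apply: (IM).
  rewrite mulrDr.
  have -> : (X - x3) * (s * q + t * ((X - x1) * (X - x2) - l * q)) =
    s * ((X - x3) * q) + t * ((X - x3) * ((X - x1) * (X - x2)) - l * ((X - x3) * q)) by ring.
  rewrite -qE; apply: (eq_of_subM (k := t) K').
  by rewrite /L; ring.
case: xi => [xi|[xE yi]].
  exists (i * ((X - x2) * L - (X - x1) * L)).
    by apply: (IM); apply: (IN).
  by apply: (eq_of_subM (k := - ((X - x3) * L)) xi); ring.
subst x2.
(* [(X - x3) (X - x1)^2 = L M] and [M = L + 2 y1 + 2 l (X - x1)]. *)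
exists (i * ((X - x3) * ((X - x1) * (X - x1)) - L ^+ 2 - (2%:R * l) * ((X - x1) * L))).
  by apply: (IM); apply: (IN); [apply: (IN) => //|]; apply: (IM).
rewrite mulrCA !(mulrBr (X - x3)).
have -> : (X - x3) * ((X - x3) * ((X - x1) * (X - x1))) = (X - x3) * (L * M).
  by apply: (eq_of_subM (k := X - x3) K); rewrite /L /M; ring.
apply: (eq_of_subM (k := - (L * (X - x3))) yi).
by rewrite /L /M; ring.
Qed.

End IdealClasses.

(** * The coordinate ring of y^2 = f(x) *)

Definition coord_ring (F : fieldType) (f : {poly F}) := ({poly F} * {poly F})%type.

Section CoordinateRing.

Variables (F : fieldType) (f : {poly F}).
Local Notation R := (coord_ring f).

HB.instance Definition _ := GRing.Zmodule.on R.

(* [(p, q)] stands for [p + q Y] with [Y ^+ 2 = f]. *)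
Definition coord_mul (u v : R) : R :=
  (u.1 * v.1 + u.2 * v.2 * f, u.1 * v.2 + u.2 * v.1).

Lemma coord_mulA : associative coord_mul.
Proof. by move=> [a b] [c d] [g h]; congr pair => /=; ring. Qed.

Lemma coord_mulC : commutative coord_mul.
Proof. by move=> [a b] [c d]; congr pair => /=; ring. Qed.

Lemma coord_mul1 : left_id ((1, 0) : R) coord_mul.
Proof. by move=> [a b]; congr pair => /=; ring. Qed.

Lemma coord_mulDl : left_distributive coord_mul +%R.
Proof. by move=> [a b] [c d] [g h]; congr pair => /=; ring. Qed.

Lemma coord_oner_neq0 : ((1, 0) : R) != 0.
Proof. by rewrite -pair_eqE /= oner_eq0. Qed.

HB.instance Definition _ := GRing.Zmodule_isComNzRing.Build R
  coord_mulA coord_mulC coord_mul1 coord_mulDl coord_oner_neq0.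

Lemma coord_mulE (u v : R) :
  u * v = (u.1 * v.1 + u.2 * v.2 * f, u.1 * v.2 + u.2 * v.1).
Proof. by []. Qed.

Definition coord_emb (p : {poly F}) : R := (p, 0).

Lemma coord_emb_is_additive : {morph coord_emb : p q / p - q}.
Proof. by move=> p q; congr pair => /=; ring. Qed.

Lemma coord_emb_is_monoid_morphism : monoid_morphism coord_emb.
Proof.
split=> [|p q]; first exact: erefl.
by rewrite coord_mulE; congr pair => /=; ring.
Qed.

HB.instance Definition _ :=
  GRing.isAdditive.Build {poly F} R coord_emb coord_emb_is_additive.
HB.instance Definition _ :=
  GRing.isMonoidMorphism.Build {poly F} R coord_emb coord_emb_is_monoid_morphism.

Definition coord_Y : R := (0, 1).

Lemma coord_Y2 : coord_Y ^+ 2 = coord_emb f.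
Proof. by rewrite expr2 coord_mulE; congr pair => /=; ring. Qed.

Definition coord_norm (u : R) : {poly F} := u.1 ^+ 2 - u.2 ^+ 2 * f.

Lemma coord_normM u v : coord_norm (u * v) = coord_norm u * coord_norm v.
Proof. by case: u v => [a b] [c d]; rewrite coord_mulE /coord_norm /=; ring. Qed.

(** Multiplying by the conjugate turns [u] into its norm, a nonzero polynomial in X, which acts
    injectively on both components. *)
Lemma lreg_norm u : coord_norm u != 0 -> GRing.lreg u.
Proof.
move=> Nu a b /= ab.
have {ab}: coord_emb (coord_norm u) * (a - b) = 0.
  have -> : coord_emb (coord_norm u) = ((u.1, - u.2) : R) * u.
    by case: u {ab Nu} => c d; rewrite coord_mulE /coord_norm; congr pair => /=; ring.
  by rewrite -mulrA mulrBr ab subrr mulr0.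
case: (a - b) (subr_eq0 a b) => c d ab0; rewrite coord_mulE /= !mul0r addr0 addr0.
move=> [/eqP + /eqP]; rewrite !mulf_eq0 (negPf Nu) /= => /eqP c0 /eqP d0.
by apply/eqP; rewrite -ab0 c0 d0.
Qed.

End CoordinateRing.

(** * The chord-tangent law and the ideal classes of points *)

Section ShortCurve.

Variables (F : numFieldType) (A B : F).
Local Notation E := (Weierstrass 0 0 0 A B).

Lemma on_short_curve x y : on_curve E (Aff x y) <-> y ^+ 2 = x ^+ 3 + A * x + B.
Proof. by rewrite /= !mul0r !addr0. Qed.

(** Chord and tangent are described together by the line [y = l x + k]. The relation on
    [l (y1 + y2)] is the slope equation cleared of its denominator, valid in both cases. *)
Variant add_spec (x1 y1 x2 y2 : F) : point F -> Prop :=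
| AddOpp of x2 = x1 & y2 = - y1 : add_spec x1 y1 x2 y2 (Inf F)
| AddChord l k x3 of y1 = l * x1 + k & y2 = l * x2 + k & x3 = l ^+ 2 - x1 - x2
    & x1 ^+ 2 + x1 * x2 + x2 ^+ 2 + A = l * (y1 + y2)
    & (x1 != x2) || [&& x1 == x2, y1 == y2 & y1 != 0]
    : add_spec x1 y1 x2 y2 (Aff x3 (- (l * x3 + k))).

Lemma add_pointP x1 y1 x2 y2 :
  on_curve E (Aff x1 y1) -> on_curve E (Aff x2 y2) ->
  add_spec x1 y1 x2 y2 (add_point E (Aff x1 y1) (Aff x2 y2)).
Proof.
move=> /on_short_curve e1 /on_short_curve e2; rewrite /= !mul0r !addr0 !subr0 mulr0 mul0r addr0.
have [x12|x12] := eqVneq x1 x2; last first.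
  have x12' : x2 - x1 != 0 by rewrite subr_eq0 eq_sym.
  set l := (y2 - y1) / (x2 - x1); rewrite /= -/l.
  have -> : - l * (l ^+ 2 - x1 - x2) - (y1 - l * x1) =
    - (l * (l ^+ 2 - x1 - x2) + (y1 - l * x1)) by ring.
  apply: AddChord => //; last by rewrite x12.
  - by ring.
  - by rewrite /l; field.
  apply: (mulIf x12').
  have -> : l * (y1 + y2) * (x2 - x1) = y2 ^+ 2 - y1 ^+ 2 by rewrite /l; field.
  by rewrite e1 e2; ring.
subst x2; rewrite /=.
have [y12|y12] := eqVneq (y1 + y2) 0.
  by apply: AddOpp => //; apply: (eq_of_subM (k := 1) y12); ring.
have y21 : y1 = y2.
  have : (y1 - y2) * (y1 + y2) = 0.
    by rewrite -subr_sqr e1 e2 subrr.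
  by move/eqP; rewrite mulf_eq0 (negPf y12) orbF subr_eq0 => /eqP.
subst y2; have y0 : y1 != 0 by apply: contra y12 => /eqP ->; rewrite addr0.
set l := _ / _.
have -> : - l * (l ^+ 2 - x1 - x1) - (y1 - l * x1) =
    - (l * (l ^+ 2 - x1 - x1) + (y1 - l * x1)) by ring.
apply: AddChord => //; last by rewrite !eqxx y0 orbT.
- by ring.
- by ring.
by rewrite /l; field.
Qed.

(** Vieta's formulas for [x^3 + A x + B - (l x + k)^2], whose roots are the three abscissas on the
    line. *)
Lemma chord_symmetric l k x1 y1 x2 y2 x3 :
  on_curve E (Aff x1 y1) ->
  y1 = l * x1 + k -> y2 = l * x2 + k -> x3 = l ^+ 2 - x1 - x2 ->
  x1 ^+ 2 + x1 * x2 + x2 ^+ 2 + A = l * (y1 + y2) ->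
  x1 * x2 + x1 * x3 + x2 * x3 = A - 2%:R * l * k /\ x1 * x2 * x3 = k ^+ 2 - B.
Proof.
move=> /on_short_curve e1 y1E y2E x3E e; subst y1 y2 x3; split.
  by apply: (eq_of_subM (k := - 1) e); ring.
have -> : B = (l * x1 + k) ^+ 2 - x1 ^+ 3 - A * x1 by rewrite e1; ring.
by apply: (eq_of_subM (k := - x1) e); ring.
Qed.

Lemma on_curve_add P Q :
  on_curve E P -> on_curve E Q -> on_curve E (add_point E P Q).
Proof.
case: P Q => [|x1 y1] [|x2 y2] // Ep Eq.
case: (add_pointP Ep Eq) => // l k x3 y1E y2E x3E e _.
have [e2 e3] := chord_symmetric Ep y1E y2E x3E e.
apply/on_short_curve.
have -> : B = k ^+ 2 - x1 * x2 * x3 by rewrite e3; ring.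
have -> : A = x1 * x2 + x1 * x3 + x2 * x3 + 2%:R * l * k by rewrite e2; ring.
by rewrite x3E; ring.
Qed.

Lemma on_curve_mul n P : on_curve E P -> on_curve E (mul_point E n P).
Proof. by move=> Ep; elim: n => //= n; apply: on_curve_add. Qed.

Definition opp_point (P : point F) := if P is Aff x y then Aff x (- y) else Inf F.

Lemma on_curve_opp P : on_curve E P -> on_curve E (opp_point P).
Proof. by case: P => // x y /on_short_curve e; apply/on_short_curve; rewrite sqrrN. Qed.

Definition short_cubic : {poly F} := 'X^3 + A%:P * 'X + B%:P.
Local Notation R := (coord_ring short_cubic).
Local Notation emb := (@coord_emb F short_cubic).
Local Notation Y := (coord_Y short_cubic).
Local Notation cst c := (emb c%:P).

(** The ideal of functions vanishing at the point; infinity is missing from the affine curve, hence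
    the unit ideal. *)
Definition point_ideal (P : point F) : R -> Prop :=
  if P is Aff x y then ideal2 (emb 'X - cst x) (Y - cst y) else @unit_ideal R.

Lemma point_ideal_ideal P : is_ideal (point_ideal P).
Proof. by case: P => [|x y] //; apply: ideal2_ideal. Qed.

Hypothesis disc_neq0 : 4%:R * A ^+ 3 + 27%:R * B ^+ 2 != 0.

(** The discriminant lies in the ideal of the cubic and its derivative. This gives smoothness over
    the field, and later, with discriminant 1, smoothness modulo p. *)
Lemma disc_bezout x : 4%:R * A ^+ 3 + 27%:R * B ^+ 2 =
  (27%:R * B - 18%:R * A * x) * (x ^+ 3 + A * x + B) +
  (6%:R * A * x ^+ 2 - 9%:R * B * x + 4%:R * A ^+ 2) * (3%:R * x ^+ 2 + A).
Proof. by ring. Qed.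

Lemma lregXsub c : GRing.lreg (emb 'X - cst c).
Proof.
apply: lreg_norm; rewrite -rmorphB /coord_norm /= expr0n /= mul0r subr0.
by rewrite expf_neq0 // polyXsubC_eq0.
Qed.

Lemma cst_inv c : c != 0 -> cst c * cst c^-1 = 1.
Proof. by move=> c0; rewrite -(rmorphM emb) -polyCM mulfV // rmorph1. Qed.

Lemma sim_opp P : on_curve E P ->
  ideal_sim (idmul (point_ideal P) (point_ideal (opp_point P))) (@unit_ideal R).
Proof.
case: P => [_|x y /on_short_curve e]; first by rewrite idmul_unit //; apply: sim_refl.
exists 1, (emb 'X - cst x); split; [exact: lreg1|exact: lregXsub|].
rewrite /= polyCN rmorphN opprK.
(* The partial derivative [2 y] is inverted, unless [y = 0], where the derivative of the cubic at
   [x] is nonzero. *)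
rewrite (@opp_ideal _ (emb 'X) Y (cst x) (cst y) (emb ('X + (2%:R * x)%:P)) 
  (cst (3%:R * x ^+ 2 + A)) (cst (if y == 0 then (3%:R * x ^+ 2 + A)^-1 else (2%:R * y)^-1))).
- by rewrite scaleA mul1r.
- rewrite -subr_sqr coord_Y2 -(rmorphXn emb) -!(rmorphB emb) -(rmorphM emb) -(rmorphD emb).
  rewrite -(rmorphM emb); congr coord_emb; rewrite -!polyC_exp e /short_cubic !(polyCD, polyCM, polyC_exp).
  by ring.
- have [y0|y0] := eqVneq y 0; [right|left].
    apply: cst_inv; apply: contra disc_neq0 => /eqP xA.
    by rewrite (disc_bezout x) xA -e y0 expr0n /= !mulr0 addr0.
  have -> : 2%:R * cst y = cst (2%:R * y)
    by rewrite polyCM (rmorphM emb) polyC_natr (rmorph_nat emb).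
  by rewrite cst_inv // mulf_neq0 // pnatr_eq0.
Qed.

Lemma short_cubic_chord l k x1 x2 x3 :
  x3 = l ^+ 2 - x1 - x2 -> x1 * x2 + x1 * x3 + x2 * x3 = A - 2%:R * l * k ->
  x1 * x2 * x3 = k ^+ 2 - B ->
  ('X - x1%:P) * ('X - x2%:P) * ('X - x3%:P) =
  short_cubic - (l%:P * 'X + k%:P) ^+ 2.
Proof.
move=> x3E e2 e3; rewrite /short_cubic.
have -> : B = k ^+ 2 - x1 * x2 * x3 by rewrite e3; ring.
have -> : A = x1 * x2 + x1 * x3 + x2 * x3 + 2%:R * l * k by rewrite e2; ring.
by rewrite x3E; ring.
Qed.

(** The multipliers are the vertical line through the third intersection and the chord. The norm of
    the chord is minus the product of the three [X - xi], so it is regular. *)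
Lemma sim_add P Q : on_curve E P -> on_curve E Q ->
  ideal_sim (point_ideal (add_point E P Q)) (idmul (point_ideal P) (point_ideal Q)).
Proof.
case: P Q => [|x1 y1] [|x2 y2] Ep Eq.
- by rewrite idmul_unit //; apply: sim_refl.
- by rewrite /= idmul_unit; [apply: sim_refl|apply: ideal2_ideal].
- by rewrite idmulC /= idmul_unit; [apply: sim_refl|apply: ideal2_ideal].
case: (add_pointP Ep Eq) => [x12 y12|l k x3 y1E y2E x3E e x12].
  by apply: sim_sym; rewrite x12 y12; exact: (sim_opp Ep).
have [e2 e3] := chord_symmetric Ep y1E y2E x3E e.
have K := short_cubic_chord x3E e2 e3.
apply: sim_sym; exists (emb 'X - cst x3), (Y - (cst l * emb 'X + cst k)); split.
- exact: lregXsub.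
- apply: lreg_norm.
  have -> : coord_norm (Y - (cst l * emb 'X + cst k)) =
     - (('X - x1%:P) * ('X - x2%:P) * ('X - x3%:P)).
    by rewrite K -(rmorphM emb) -(rmorphD emb) /coord_norm /=; ring.
  by rewrite oppr_eq0 !mulf_neq0 // polyXsubC_eq0.
- have -> : point_ideal (Aff x3 (- (l * x3 + k))) =
     ideal2 (emb 'X - cst x3) (Y + (cst l * cst x3 + cst k)).
    by rewrite /= -(rmorphM emb) -(rmorphD emb) -polyCM -polyCD polyCN rmorphN opprK.
  apply: (@chord_ideal _ _ _ _ _ _ _ _ _ _
    (cst (if x1 == x2 then (2%:R * y1)^-1 else (x1 - x2)^-1))).
  + by rewrite y1E -(rmorphM emb) -(rmorphD emb) -polyCM -polyCD.
  + by rewrite y2E -(rmorphM emb) -(rmorphD emb) -polyCM -polyCD.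
  + rewrite coord_Y2 -(rmorphM emb) -(rmorphD emb) -(rmorphXn emb) -!(rmorphB emb) -!(rmorphM emb).
    by rewrite K.
  move: x12; have [<- /= /andP[_ y0]|x12 _] := eqVneq x1 x2; [right|left].
    split=> //.
    have -> : 2%:R * cst y1 = cst (2%:R * y1)
      by rewrite polyCM (rmorphM emb) polyC_natr (rmorph_nat emb).
    by rewrite cst_inv // mulf_neq0 // pnatr_eq0.
  by rewrite -(rmorphB emb) -polyCB cst_inv // subr_eq0.
Qed.

Lemma size_short_cubic : size short_cubic = 4%N.
Proof.
rewrite /short_cubic -addrA size_polyDl size_polyXn // size_MXaddC.
by case: ifP => // _; rewrite !ltnS (leq_trans (size_polyC_leq1 _)).
Qed.

Lemma size_sqr (p : {poly F}) : p != 0 -> size (p ^+ 2) = (size p).-1.*2.+1.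
Proof.
move=> p0; rewrite expr2 size_mul // -addnn.
by have := p0; rewrite -size_poly_gt0; case: (size p) => // n _; rewrite addSn addnS.
Qed.

(** The degrees of [a^2] and [b^2 f] have opposite parities, so they cannot cancel, and the second
    is at least 3. *)
Lemma size_coord_norm (u : R) : u.2 != 0 -> (3 < size (coord_norm u))%N.
Proof.
case: u => a b /= b0; rewrite /coord_norm /=.
have f0 : short_cubic != 0 by rewrite -size_poly_gt0 size_short_cubic.
have sb : size (b ^+ 2 * short_cubic) = (size b).+1.*2.
  rewrite size_mul ?expf_neq0 // size_short_cubic size_sqr // addnS /= doubleS.
  by have := b0; rewrite -size_poly_gt0; case: (size b) => // n _;
  rewrite doubleS !addSn !addnS addn0.
have b_gt0 : (0 < size b)%N by rewrite size_poly_gt0.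
have [->|a0] := eqVneq a 0.
  by rewrite expr0n /= sub0r size_polyN sb doubleS; case: (size b) b_gt0.
have [lt_ab|lt_ba|eq_ab] := ltngtP (size (a ^+ 2)) (size (b ^+ 2 * short_cubic)).
- rewrite addrC size_polyDl size_polyN // sb doubleS.
  by case: (size b) b_gt0.
- rewrite size_polyDl; last by rewrite size_polyN.
  apply: leq_trans lt_ba; rewrite sb doubleS.
  by case: (size b) b_gt0.
by have := congr1 odd eq_ab; rewrite size_sqr // sb /= !odd_double.
Qed.

(* If [(b) = a I] with [I = (X - u, Y - v)], then [I = (k)] and the norm of [k] divides
   [(X - u)^2]; since the cubic has degree 3 this forces [k] to be a polynomial in [X], which
   vanishes at [u] and divides [Y - v]. *)
Lemma point_ideal_trivial P : on_curve E P ->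
  ideal_sim (point_ideal P) (@unit_ideal R) -> P = Inf F.
Proof.
case: P => // u v /on_short_curve e [a [b [ra rb ab]]].
have [k [s [t kE]] bE] : scale a (point_ideal (Aff u v)) b.
  by rewrite ab; exists 1; rewrite ?mulr1.
have gen z : point_ideal (Aff u v) z -> exists g, z = k * g.
  move=> Iz; have [g _ zE] : scale b (@unit_ideal R) (a * z) by rewrite -ab; exists z.
  by exists g; apply: ra; rewrite zE bE mulrA.
have [g gE] : exists g, emb 'X - cst u = k * g by apply: gen; exists 1, 0; ring.
have [h hE] : exists h, Y - cst v = k * h by apply: gen; exists 0, 1; ring.
have Ng : ('X - u%:P) ^+ 2 = coord_norm k * coord_norm g.
  by rewrite -coord_normM -gE -(rmorphB emb) /coord_norm /= expr0n /= mul0r subr0.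
have k0 : coord_norm k != 0.
  apply/eqP=> k0; move/eqP: Ng; rewrite k0 mul0r expf_eq0 /= => /eqP.
  by apply/eqP; rewrite polyXsubC_eq0.
have g0 : coord_norm g != 0.
  apply/eqP=> g0; move/eqP: Ng; rewrite g0 mulr0 expf_eq0 /= => /eqP.
  by apply/eqP; rewrite polyXsubC_eq0.
have sz : (size (coord_norm k) + size (coord_norm g))%N = 4%N.
  have := congr1 (fun q : {poly F} => size q) Ng; rewrite /= size_exp_XsubC size_mul //.
  by rewrite -!subn1; case: (_ + _)%N => // n; rewrite subn1 /= => <-.
have sg : (0 < size (coord_norm g))%N by rewrite size_poly_gt0.
have k_ev : k.1.[u] + k.2.[u] * v = 0.
  by rewrite kE !coord_mulE /short_cubic /= !hornerE /= -e; ring.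
have k2 : k.2 = 0.
  apply/eqP; apply: contraTT isT => /size_coord_norm sk3.
  have : (4 + 1 <= 4)%N by rewrite -[X in (_ <= X)%N]sz leq_add.
  by [].
have : (k.1 * h.2).[u] = 1.
  have := congr1 snd hE; rewrite coord_mulE /= k2 mul0r addr0 subr0 => <-.
  by rewrite hornerC.
move: k_ev; rewrite k2 horner0 mul0r addr0 hornerM => ->; rewrite mul0r => /eqP.
by rewrite eq_sym oner_eq0.
Qed.

Lemma sim_mulp n P : on_curve E P ->
  ideal_sim (point_ideal (mul_point E n P)) (idexp (point_ideal P) n).
Proof.
move=> Ep; elim: n => [|n IH] /=; first exact: sim_refl.
apply: (sim_trans (sim_add Ep (on_curve_mul n Ep))).
by apply: sim_mul => //; apply: sim_refl.
Qed.

(** Iterated addition becomes a power of an ideal class, where products are associative and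
    commutative; this stands in for associativity of the chord-tangent law. *)
Lemma mul_point_InfP n P : on_curve E P ->
  mul_point E n P = Inf F <-> ideal_sim (idexp (point_ideal P) n) (@unit_ideal R).
Proof.
move=> Ep; have simP := sim_mulp n Ep; split=> [nP|nP].
  by rewrite nP in simP; apply: sim_sym.
by apply: point_ideal_trivial; [exact: on_curve_mul|exact: (sim_trans simP)].
Qed.

Lemma mul_point_mul m n P : on_curve E P ->
  mul_point E n (mul_point E m P) = Inf F <-> mul_point E (m * n) P = Inf F.
Proof.
move=> Ep; have simP := sim_exp n (sim_mulp m Ep).
rewrite !mul_point_InfP //; last exact: on_curve_mul.
rewrite (idexpM _ _ (point_ideal_ideal P)); split; apply: sim_trans => //.
exact: sim_sym.
Qed.

Lemma mul_point_add n P Q : on_curve E P -> on_curve E Q ->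
  mul_point E n P = Inf F -> mul_point E n Q = Inf F ->
  mul_point E n (add_point E P Q) = Inf F.
Proof.
move=> Ep Eq; rewrite !mul_point_InfP //; last exact: on_curve_add.
move=> nP nQ; apply: (sim_trans (sim_exp n (sim_add Ep Eq))).
rewrite idexp_mul; apply: (sim_trans (sim_mul nP nQ)).
by rewrite idmul_unit //; apply: sim_refl.
Qed.

Lemma torsion_opp P : torsion_point E P -> torsion_point E (opp_point P).
Proof.
move=> [Ep [n [n0 nP]]]; split; first exact: on_curve_opp.
have Eo := on_curve_opp Ep.
exists n; split=> //; move: nP; rewrite !mul_point_InfP // => nP.
apply: (@sim_trans _ (idexp (idmul (point_ideal P) (point_ideal (opp_point P))) n)).
  rewrite idexp_mul.
  rewrite -[X in ideal_sim X _]idmul_unit; last exact/idexp_ideal/point_ideal_ideal.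
  by apply: sim_mul; [apply: sim_sym|apply: sim_refl].
by apply: (sim_trans (sim_exp n (sim_opp Ep))); rewrite idexp_unit; apply: sim_refl.
Qed.

Lemma torsion_add P Q :
  torsion_point E P -> torsion_point E Q -> torsion_point E (add_point E P Q).
Proof.
move=> [Ep [m [m0 mP]]] [Eq [n [n0 nQ]]]; split; first exact: on_curve_add.
exists (m * n)%N; rewrite muln_gt0 m0 n0; split=> //.
have mul_Inf k : mul_point E k (Inf F) = Inf F by elim: k => //= k ->.
apply: mul_point_add => //; first by rewrite -mul_point_mul // mP mul_Inf.
by rewrite mulnC -mul_point_mul // nQ mul_Inf.
Qed.

End ShortCurve.

(** * Torsion points near infinity *)

Section TorsionSeparation.

Variables (F : numFieldType) (V : subringClosed F) (p : nat) (A B : F).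
Hypothesis valV : forall x, (x \in V) || (x^-1 \in V).
Hypothesis pV : p%:R^-1 \notin V.
Hypothesis p_prime : prime p.
Hypothesis p_gt2 : (2 < p)%N.
Hypotheses (AV : A \in V) (BV : B \in V).
Hypothesis disc1 : 4%:R * A ^+ 3 + 27%:R * B ^+ 2 = 1.
Local Notation E := (Weierstrass 0 0 0 A B).

Let p0 : p%:R != 0 :> F := char_neq0 pV.

Lemma disc1_neq0 : 4%:R * A ^+ 3 + 27%:R * B ^+ 2 != 0.
Proof. by rewrite disc1 oner_neq0. Qed.

(* The parameter [z = x / y] at infinity, up to sign. *)
Definition zcoord (P : point F) : F := if P is Aff x y then x / y else 0.

(** The two exponents reflect that, at infinity, [z = x / y] vanishes to order 1 and [w = 1 / y] to
    order 3. *)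
Definition near_inf (c : F) (P : point F) : Prop :=
  if P is Aff x y then
    [/\ y != 0, exists2 a, a \in V & x / y = c * a
      & exists2 b, b \in V & y^-1 = c ^+ 3 * b]
  else True.

Lemma chart_eq x y : y != 0 -> on_curve E (Aff x y) ->
  y^-1 = (x / y) ^+ 3 + A * (x / y) * y^-1 ^+ 2 + B * y^-1 ^+ 3.
Proof.
move=> y0 /on_short_curve e.
have -> : (x / y) ^+ 3 + A * (x / y) * y^-1 ^+ 2 + B * y^-1 ^+ 3 =
  (x ^+ 3 + A * x + B) / y ^+ 3 by field.
by rewrite -e; field.
Qed.

(* The slope of the chord, resp. tangent, in the chart [(z, w)] is [N / D]. *)
Lemma chart_slope x1 y1 x2 y2 l k (z1 := x1 / y1) (w1 := y1^-1) (z2 := x2 / y2) (w2 := y2^-1)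
    (N := z1 ^+ 2 + z1 * z2 + z2 ^+ 2 + A * w2 ^+ 2)
    (D := 1 - A * z1 * (w1 + w2) - B * (w1 ^+ 2 + w1 * w2 + w2 ^+ 2)) :
  on_curve E (Aff x1 y1) -> on_curve E (Aff x2 y2) -> y1 != 0 -> y2 != 0 ->
  y1 = l * x1 + k -> y2 = l * x2 + k ->
  x1 ^+ 2 + x1 * x2 + x2 ^+ 2 + A = l * (y1 + y2) ->
  (x1 != x2) || [&& x1 == x2, y1 == y2 & y1 != 0] ->
  D != 0 -> l * D = - (k * N).
Proof.
move=> E1 E2 y10 y20 y1E y2E e x12 D0.
have c1 := chart_eq y10 E1; have c2 := chart_eq y20 E2.
have l1 : l * z1 + k * w1 = 1.
  by apply: (mulIf y10); rewrite mul1r [RHS]y1E /z1 /w1; field.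
have l2 : l * z2 + k * w2 = 1.
  by apply: (mulIf y20); rewrite mul1r [RHS]y2E /z2 /w2; field.
rewrite -/z1 -/w1 in c1; rewrite -/z2 -/w2 in c2.
(* Difference of the two chart equations, factored. It is trivial when the points coincide, so the
   tangent case is treated separately. *)
have key : (w1 - w2) * D = (z1 - z2) * N.
  have -> : (w1 - w2) * D = w1 - w2 - A * z1 * (w1 ^+ 2 - w2 ^+ 2) - B * (w1 ^+ 3 - w2 ^+ 3).
    by rewrite /D; ring.
  by rewrite {1}c1 {1}c2 /N; ring.
case/orP: x12 => [x12|/and3P[/eqP x12 /eqP y12 _]].
  have z12 : z1 - z2 != 0.
    apply: contra x12 => /eqP z12; move/eqP: key; rewrite z12 mul0r mulf_eq0 (negPf D0) orbF.
    rewrite subr_eq0 => /eqP /invr_inj y12; move/eqP: z12; rewrite subr_eq0 /z1 /z2 y12.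
    by move=> /eqP /(mulIf (invr_neq0 y20)) ->.
  apply: (mulIf z12); apply: (eq_of_subM (k := D) (etrans l1 (esym l2))).
  have -> : - (k * N) * (z1 - z2) = - (k * ((z1 - z2) * N)) by ring.
  by rewrite -key; ring.
have z12 : z2 = z1 by rewrite /z1 /z2 x12 y12.
have w12 : w2 = w1 by rewrite /w1 /w2 y12.
have lN : N = 2%:R * l * w1.
  have -> : N = (x1 ^+ 2 + x1 * x2 + x2 ^+ 2 + A) * w1 ^+ 2.
    by rewrite /N w12 z12 /z1 -x12 -/w1; ring.
  by rewrite e -y12 /w1; field.
have w10 : w1 != 0 by rewrite invr_eq0.
apply: (mulIf w10).
have -> : l * D * w1 = l * (- (2%:R * w1) + z1 * N).
  rewrite -mulrA; congr (_ * _).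
  have -> : D * w1 = w1 - 2%:R * (A * z1 * w1 ^+ 2 + B * w1 ^+ 3) - B * w1 ^+ 3.
    by rewrite /D w12; ring.
  have -> : B * w1 ^+ 3 = w1 - z1 ^+ 3 - A * z1 * w1 ^+ 2 by rewrite {2}c1; ring.
  by rewrite /N w12 z12; ring.
rewrite lN.
have -> : - (k * (2%:R * l * w1)) * w1 = - (2%:R * l * w1) * (k * w1) by ring.
have -> : k * w1 = 1 - l * z1 by rewrite -l1; ring.
by ring.
Qed.

(** In the chart the line is [w = c^2 m z + c^3 n] with [m], [n] in V. Substituting it into the
    curve gives a cubic in [z] whose roots sum to [- c^5 q]; the denominators [D] and [U] are 1
    modulo p, hence units. *)
Lemma near_inf_add c P Q : (exists2 a, a \in V & c = p%:R * a) ->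
  on_curve E P -> on_curve E Q -> near_inf c P -> near_inf c Q ->
  near_inf c (add_point E P Q) /\
  exists2 e, e \in V & zcoord (add_point E P Q) = zcoord P + zcoord Q + c ^+ 3 * e.
Proof.
move=> [c' c'V cE].
have cV : c \in V by rewrite cE; rpred_auto.
case: P Q => [|x1 y1] [|x2 y2] E1 E2 n1 n2; try by split=> //=; exists 0; rewrite ?rpred0 //; ring.
have [y10 [a1 a1V z1E] [b1 b1V w1E]] := n1; have [y20 [a2 a2V z2E] [b2 b2V w2E]] := n2.
case: (add_pointP E1 E2) => [x12 y12|l k x3 y1E y2E x3E e x12].
  by split=> //; exists 0; rewrite ?rpred0 //= x12 y12; field.
have [s2 s3] := chord_symmetric E1 y1E y2E x3E e.
have slope := chart_slope E1 E2 y10 y20 y1E y2E e x12.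
rewrite /= z1E z2E w1E w2E in slope.
pose d := - (A * c' * a1 * (c ^+ 3 * (b1 + b2)) + B * c' * c ^+ 5 * (b1 ^+ 2 + b1 * b2 + b2 ^+ 2)).
have dV : d \in V by rewrite /d; rpred_auto.
have DE : 1 - A * (c * a1) * (c ^+ 3 * b1 + c ^+ 3 * b2) 
    - B * ((c ^+ 3 * b1) ^+ 2 + c ^+ 3 * b1 * (c ^+ 3 * b2) + (c ^+ 3 * b2) ^+ 2) = 1 + p%:R * d.
  by rewrite /d cE; ring.
have D0 := principal_unit_neq0 pV dV; have DV := principal_unitV valV pV dV.
rewrite DE in slope; move/(_ D0): slope => slope.
set D := 1 + p%:R * d in slope D0 DV.
pose m := (a1 ^+ 2 + a1 * a2 + a2 ^+ 2 + A * c ^+ 4 * b2 ^+ 2) / D.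
have mV : m \in V by rewrite /m; rpred_auto.
have lE : l = - (k * (c ^+ 2 * m)).
  by apply: (mulIf D0); rewrite slope /m; field.
pose n := b1 - m * a1.
have nV : n \in V by rewrite /n; rpred_auto.
have kn : k * (c ^+ 3 * n) = 1.
  have <- : l * (c * a1) + k * (c ^+ 3 * b1) = 1.
    by rewrite -z1E -w1E; apply: (mulIf y10); rewrite mul1r [RHS]y1E; field.
  by rewrite lE /n; ring.
have k0 : k != 0 by apply: contraPneq kn => ->; rewrite mul0r => /eqP;
  rewrite eq_sym oner_eq0.
(* [U = 1 + p u] is the leading coefficient of the cubic in [z], for the slope [c^2 m]. *)
pose u := A * c' * c ^+ 3 * m ^+ 2 + B * c' * c ^+ 5 * m ^+ 3.
have uV : u \in V by rewrite /u; rpred_auto.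
have U0 := principal_unit_neq0 pV uV; have UV := principal_unitV valV pV uV.
set U := 1 + p%:R * u in U0 UV.
have UE : U = 1 + A * (c ^+ 2 * m) ^+ 2 + B * (c ^+ 2 * m) ^+ 3.
  by rewrite /U /u [in RHS]cE [in LHS]cE; ring.
have prodE : y1 * y2 * (l * x3 + k) = k ^+ 3 * U.
  have -> : y1 * y2 * (l * x3 + k) = l ^+ 3 * (x1 * x2 * x3) +
     l ^+ 2 * k * (x1 * x2 + x1 * x3 + x2 * x3) + l * k ^+ 2 * (x1 + x2 + x3) + k ^+ 3.
    by rewrite {1}y1E {1}y2E; ring.
  by rewrite s2 s3 x3E UE lE; ring.
have y30 : l * x3 + k != 0.
  have : y1 * y2 * (l * x3 + k) != 0 by rewrite prodE mulf_neq0 ?expf_neq0.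
  by rewrite mulf_eq0 => /norP[].
(* Numerator of the sum of the three [z]-coordinates on the line; [prodE] evaluates its
   denominator. *)
have sumE : x1 * y2 * (l * x3 + k) + x2 * y1 * (l * x3 + k) + x3 * y1 * y2 =
    2%:R * A * l * k - 3%:R * B * l ^+ 2.
  have -> : x1 * y2 * (l * x3 + k) + x2 * y1 * (l * x3 + k) + x3 * y1 * y2 =
     3%:R * l ^+ 2 * (x1 * x2 * x3) +
     2%:R * l * k * (x1 * x2 + x1 * x3 + x2 * x3) + k ^+ 2 * (x1 + x2 + x3).
    by rewrite {1 2}y1E {1 2}y2E; ring.
  by rewrite s2 s3 x3E; ring.
pose q := (2%:R * A * m * n + 3%:R * B * c ^+ 2 * m ^+ 2 * n) / U.
have qV : q \in V by rewrite /q; rpred_auto.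
have z3E : x3 / - (l * x3 + k) = c * a1 + c * a2 + c ^+ 5 * q.
  rewrite -z1E -z2E.
  have -> : c ^+ 5 * q = - (2%:R * A * l * k - 3%:R * B * l ^+ 2) / (k ^+ 3 * U).
    apply: (eq_of_subM
      (k := (2%:R * A * c ^+ 2 * m + 3%:R * B * c ^+ 4 * m ^+ 2) / (k * U)) kn).
    by rewrite lE /q; field; rewrite k0 U0.
  rewrite -sumE -prodE; field.
  by rewrite y10 y20 y30.
split; last first.
  by exists (c ^+ 2 * q); [rpred_auto|rewrite /= z3E z1E z2E; ring].
split; first by rewrite oppr_eq0.
  by exists (a1 + a2 + c ^+ 4 * q); [rpred_auto|rewrite z3E; ring].
exists (m * (a1 + a2 + c ^+ 4 * q) - n); first by rpred_auto.
have -> : c ^+ 3 * (m * (a1 + a2 + c ^+ 4 * q) - n) =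
   c ^+ 2 * m * (c * a1 + c * a2 + c ^+ 5 * q) - c ^+ 3 * n by ring.
rewrite -z3E.
have -> : c ^+ 3 * n = k^-1 by apply: (mulfI k0); rewrite kn mulfV.
have -> : c ^+ 2 * m = - l / k by rewrite lE; field.
by field; rewrite y30 k0.
Qed.


Lemma mul_pointS n P : mul_point E n.+1 P = add_point E P (mul_point E n P).
Proof. by []. Qed.

Lemma near_inf_mul c P n : (exists2 a, a \in V & c = p%:R * a) ->
  on_curve E P -> near_inf c P ->
  near_inf c (mul_point E n P) /\
  exists2 e, e \in V & zcoord (mul_point E n P) = n%:R * zcoord P + c ^+ 3 * e.
Proof.
move=> cp Ep nP; elim: n => [|n [nnP [e eV zE]]].
  by split=> //; exists 0; rewrite ?rpred0 // mul0r mulr0 addr0.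
have [nS [e' e'V zE']] := near_inf_add cp Ep (on_curve_mul n Ep) nP nnP.
split=> //; exists (e + e'); first by rpred_auto.
rewrite mul_pointS zE' zE -natr1.
by ring.
Qed.

(** Near infinity [w] is [z^3] times a unit, so the level [c] can be sharpened to [z] itself, as
    needed after each multiplication by [p]. *)
Lemma near_inf_zcoord c x y : (exists2 a, a \in V & c = p%:R * a) ->
  on_curve E (Aff x y) -> near_inf c (Aff x y) -> near_inf (x / y) (Aff x y).
Proof.
move=> [c' c'V cE] Ep [y0 [a aV zE] [b bV wE]].
have cV : c \in V by rewrite cE; rpred_auto.
split=> //; first by exists 1; rewrite ?rpred1 ?mulr1.
pose e := - (A * c' * a * c ^+ 3 * b + B * c' * c ^+ 5 * b ^+ 2).
have eV : e \in V by rewrite /e; rpred_auto.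
exists (1 + p%:R * e)^-1; first exact: principal_unitV.
have e0 := principal_unit_neq0 pV eV.
have -> : (x / y) ^+ 3 = y^-1 * (1 + p%:R * e).
  have -> : (x / y) ^+ 3 = y^-1 - A * (x / y) * y^-1 ^+ 2 - B * y^-1 ^+ 3.
    by apply: (eq_of_subM (k := - 1) (chart_eq y0 Ep)); ring.
  by rewrite zE wE /e cE; ring.
by rewrite mulfK.
Qed.

(* Multiplication by [p] multiplies [z] by [p] times a unit, and multiplication by an integer
   prime to [p] multiplies it by a unit. *)
Lemma near_inf_torsion_free N c' x y : c' \in V -> x / y = p%:R * c' -> x != 0 ->
  on_curve E (Aff x y) -> near_inf (x / y) (Aff x y) -> (0 < N)%N ->
  mul_point E N (Aff x y) <> Inf F.
Proof.
elim/ltn_ind: N c' x y => N IH c' x y c'V zE x0 Ep nP N_gt0 NP.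
have y0 : y != 0 by case: nP.
have z0 : x / y != 0 by rewrite mulf_neq0 ?invr_eq0.
have [c cE] : exists c, c = x / y by exists (x / y).
rewrite -cE in zE z0 nP.
have cV : c \in V by rewrite zE; rpred_auto.
have cp : exists2 a, a \in V & c = p%:R * a by exists c'.
have [/dvdnP[N' NE]|coN] := boolP (p %| N)%N; last first.
  have [_ [e eV]] := near_inf_mul N cp Ep nP; rewrite NP /= -cE => e0.
  have NV : N%:R^-1 \in V.
    by apply: (coprime_invV valV pV N_gt0); rewrite coprime_sym prime_coprime.
  have N0 : N%:R != 0 :> F by rewrite pnatr_eq0 -lt0n.
  have : 1 + p%:R * (N%:R^-1 * c' * c * e) != 0 by apply: principal_unit_neq0 => //; rpred_auto.
  case/negP; apply/eqP; apply: (mulfI z0); rewrite mulr0.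
  have -> : c * (1 + p%:R * (N%:R^-1 * c' * c * e)) = N%:R^-1 * (N%:R * c + c ^+ 3 * e).
    by rewrite [in RHS]exprSr [in X in _ ^+ 2 * X]zE; field.
  by rewrite -e0 mulr0.
have N'_gt0 : (0 < N')%N by move: N_gt0; rewrite NE muln_gt0 => /andP[].
have ltN' : (N' < N)%N by rewrite NE ltn_Pmulr // prime_gt1.
have : mul_point E N' (mul_point E p (Aff x y)) = Inf F.
  by apply/(mul_point_mul disc1_neq0) => //; rewrite mulnC -NE.
have [] := near_inf_mul p cp Ep nP.
have := on_curve_mul p Ep.
case: (mul_point E p (Aff x y)) => [|x' y'] Ep' nP' [e eV]; rewrite [zcoord (Aff x y)]/= -cE.
  have e'0 : 1 + p%:R * (c' ^+ 2 * e) != 0 by apply: principal_unit_neq0 => //; rpred_auto.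
  rewrite [zcoord _]/= => zE' _.
  have : p%:R * c * (1 + p%:R * (c' ^+ 2 * e)) != 0 by rewrite !mulf_neq0.
  by case/negP; apply/eqP; rewrite zE'; rewrite zE; ring.
rewrite [zcoord _]/= => z'E.
have e'0 : 1 + p%:R * (c' ^+ 2 * e) != 0 by apply: principal_unit_neq0 => //; rpred_auto.
have {}z'E : x' / y' = p%:R * (c * (1 + p%:R * (c' ^+ 2 * e))).
  by rewrite z'E zE; ring.
apply: (IH _ ltN' _ _ _ _ z'E) => //; first by rpred_auto.
  have : x' / y' != 0 by rewrite z'E !mulf_neq0.
  by apply: contra => /eqP ->; rewrite mul0r.
exact: near_inf_zcoord cp Ep' nP'.
Qed.

(** If [1/x = p^2 t], then [y^2 = x^3 u] with [u] a unit, so [(x / y)^2 = p^2 t / u] and [x / y]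
    lies in pV. *)
Lemma torsion_not_near_inf x y t :
  torsion_point E (Aff x y) -> x != 0 -> t \in V -> x^-1 <> p%:R ^+ 2 * t.
Proof.
move=> [Ep [N [N_gt0 NP]]] x0 tV xE.
pose e := p%:R ^+ 3 * t ^+ 2 * A + p%:R ^+ 5 * t ^+ 3 * B.
have eV : e \in V by rewrite /e; rpred_auto.
have e0 := principal_unit_neq0 pV eV; have e'V := principal_unitV valV pV eV.
set u := 1 + p%:R * e in e0 e'V.
have uV : u \in V by rewrite /u; rpred_auto.
have yE : y ^+ 2 = x ^+ 3 * u.
  move/on_short_curve: Ep => ->.
  have -> : u = 1 + A * x^-1 ^+ 2 + B * x^-1 ^+ 3 by rewrite xE /u /e; ring.
  by field.
have y0 : y != 0 by rewrite -sqrf_eq0 yE mulf_neq0 ?expf_neq0.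
pose c' := x / y / p%:R.
have c'V : c' \in V.
  apply: (val_sqrt valV).
  have -> : c' ^+ 2 = x ^+ 2 / (x ^+ 3 * u) / p%:R ^+ 2 by rewrite -yE /c'; field; rewrite p0 y0.
  have -> : x ^+ 2 / (x ^+ 3 * u) / p%:R ^+ 2 = t * u^-1.
    have -> : t = x^-1 / p%:R ^+ 2 by rewrite xE; field.
    by field; rewrite x0 p0 e0.
  by rpred_auto.
apply: (near_inf_torsion_free c'V _ x0 Ep _ N_gt0 NP).
  by rewrite /c'; field; rewrite p0 y0.
split=> //; first by exists 1; rewrite ?rpred1 ?mulr1.
exists u => //.
have -> : (x / y) ^+ 3 * u = x ^+ 3 * u / y ^+ 3 by field.
by rewrite -yE; field.
Qed.

Lemma val_x_of_y x y : on_curve E (Aff x y) -> y \in V -> x \in V.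
Proof.
move=> /on_short_curve e yV; have [//|xV] := orP (valV x).
have [->|x0] := eqVneq x 0; first exact: rpred0.
apply: (val_sqrt valV).
have -> : x ^+ 2 = (x ^+ 3 + A * x + B) * x^-1 - A - B * x^-1 by field.
by rewrite -e; rpred_auto.
Qed.

Lemma val_x_div_sqr_y x y : on_curve E (Aff x y) -> y != 0 -> y^-1 \in V -> x / y ^+ 2 \in V.
Proof.
move=> /on_short_curve e y0 yV; have [xV|xV] := orP (valV x).
  by rewrite -exprVn; rpred_auto.
have [->|x0] := eqVneq x 0; first by rewrite mul0r rpred0.
have [//|gV] := orP (valV (x / y ^+ 2)).
suff xV' : x \in V by rewrite -exprVn; rpred_auto.
apply: (val_sqrt valV).
have -> : x ^+ 2 = (x ^+ 3 + A * x + B) / x - A - B * x^-1 by field.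
rewrite -e; have -> : y ^+ 2 / x = (x / y ^+ 2)^-1 by field; rewrite x0 y0.
by rpred_auto.
Qed.

(* The slope of the line through [(x1, y1)] and [(x2, - y2)] is so large that the abscissa
   of the difference of the two points is at least as large as [p^-2]. *)
Lemma torsion_sep_aux x1 y1 x2 y2 e s :
  torsion_point E (Aff x1 y1) -> torsion_point E (Aff x2 y2) -> x1 != x2 ->
  e \in V -> x1 - x2 = p%:R ^+ 2 * e -> s \in V -> y1 - y2 <> s * (y1 + y2).
Proof.
move=> T1 T2 x12 eV x12E sV sE.
have [E1 _] := T1; have [E2 _] := T2.
have T3 := torsion_add disc1_neq0 T1 (torsion_opp disc1_neq0 T2).
have E2' := on_curve_opp E2; rewrite /opp_point in T3 E2'.
case: (add_pointP E1 E2') T3 => [x21|l k x3 y1E y2E x3E lE _ T3].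
  by rewrite x21 eqxx in x12.
have d0 : x1 - x2 != 0 by rewrite subr_eq0.
have V2 : 2%:R^-1 \in V.
  by apply: (coprime_invV valV pV) => //; rewrite prime_coprime // dvdn_prime2 // neq_ltn p_gt2.
have n2 : 2%:R != 0 :> F by rewrite pnatr_eq0.
(* These bounds make [x1] and [x2] negligible against [l^2], so [x3] is [l^2] times a unit. *)
have [l0 [r rV lr] [q qV xq]] :
  [/\ l != 0, exists2 r, r \in V & l^-1 = p%:R * r
    & exists2 q, q \in V & x1 * l^-1 ^+ 2 = p%:R * q].
  have lxE : l * (x1 - x2) = y1 + y2 by rewrite y1E -[y2]opprK y2E; ring.
  (* If [1/y1] is in V, then [y1 + y2 = 2 y1 / (1 + s)] and [l = (y1 + y2) / (x1 - x2)] is large. *)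
  have [y1V|y1V] := boolP ((y1 != 0) && (y1^-1 \in V)).
    have [y10 {}y1V] := andP y1V.
    have y12 : (1 + s) * (y1 + y2) = 2%:R * y1 by rewrite mulrDl -sE; ring.
    have y12_0 : y1 + y2 != 0.
      have : (1 + s) * (y1 + y2) != 0 by rewrite y12 mulf_neq0.
      by rewrite mulf_eq0 => /norP[].
    have l0 : l != 0 by move: y12_0; rewrite -lxE mulf_eq0 => /norP[].
    have lE' : l^-1 = p%:R ^+ 2 * (e * (1 + s) * 2%:R^-1 * y1^-1).
      have -> : l^-1 = (x1 - x2) * (1 + s) / ((1 + s) * (y1 + y2)).
        rewrite -lxE; field; rewrite d0 l0 /=.
        have : (1 + s) * (y1 + y2) != 0 by rewrite y12 mulf_neq0.
        by rewrite mulf_eq0 => /norP[].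
      by rewrite y12 x12E; field; rewrite y10.
    have gV := val_x_div_sqr_y E1 y10 y1V.
    split=> //.
      by exists (p%:R * (e * (1 + s) * 2%:R^-1 * y1^-1)); [rpred_auto|rewrite lE'; ring].
    exists (p%:R ^+ 3 * (e * (1 + s) * 2%:R^-1) ^+ 2 * (x1 / y1 ^+ 2)); first by rpred_auto.
    by rewrite lE'; field; rewrite y10.
  have {}y1V' : y1 \in V by have [//|y1V'] := orP (valV y1);
    move: y1V; rewrite y1V' andbT negbK => /eqP ->; rewrite rpred0.
  have x1V := val_x_of_y E1 y1V'.
  have x2V : x2 \in V.
    have -> : x2 = x1 - (x1 - x2) by ring.
    by rewrite x12E; rpred_auto.
  (* Now [y1] is a non-unit of V, so by [disc_bezout] the derivative [g] is a unit. *)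
  set g := 3%:R * x1 ^+ 2 + A.
  have gV : g \in V by rewrite /g; rpred_auto.
  have [g0 g'V] : g != 0 /\ g^-1 \in V.
    have := disc_bezout A B x1; rewrite disc1 -(proj1 (on_short_curve _ _ _ _) E1) -/g.
    set u := 27%:R * B - _; set w := 6%:R * A * _ - _ + _ => bez.
    have uV : u \in V by rewrite /u; rpred_auto.
    have wV : w \in V by rewrite /w; rpred_auto.
    have [|||/andP[]|/andP[]] := val_local valV (a := u * y1 ^+ 2) (b := w * g).
    - by rpred_auto.
    - by rpred_auto.
    - by rewrite -bez.
    - rewrite mulf_eq0 sqrf_eq0 => /norP[u0 y10] uyV; case/negP: y1V; rewrite y10 /=.
      have -> : y1^-1 = u * y1 * (u * y1 ^+ 2)^-1 by field; rewrite u0 y10.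
      by rpred_auto.
    rewrite mulf_eq0 => /norP[w0 g0] wgV; split=> //.
    have -> : g^-1 = w * (w * g)^-1 by field; rewrite w0 g0.
    by rpred_auto.
  pose f := - (p%:R * e * (2%:R * x1 + x2)) / g.
  have fV : f \in V by rewrite /f; rpred_auto.
  have f0 := principal_unit_neq0 pV fV; have f'V := principal_unitV valV pV fV.
  have hE : l * (y1 - y2) = g * (1 + p%:R * f).
    rewrite -lE.
    have -> : g * (1 + p%:R * f) = g - (p%:R ^+ 2 * e) * (2%:R * x1 + x2) by rewrite /f; field.
    by rewrite -x12E /g; ring.
  have h0 : l * (y1 - y2) != 0 by rewrite hE mulf_neq0.
  have l0 : l != 0 by move: h0; rewrite mulf_eq0 => /norP[].
  (* By the hypothesis on [s], [(y1 - y2)^2 = s l (x1 - x2) (y1 - y2)], where [l (y1 - y2)] is a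
     unit and [x1 - x2] is in p^2 V. *)
  have r0V : (y1 - y2) / p%:R \in V.
    apply: (val_sqrt valV).
    have -> : ((y1 - y2) / p%:R) ^+ 2 = s * e * g * (1 + p%:R * f).
      have -> : s * e * g * (1 + p%:R * f) = s * e * (l * (y1 - y2)) by rewrite hE; ring.
      have -> : ((y1 - y2) / p%:R) ^+ 2 = (y1 - y2) * (y1 - y2) / p%:R ^+ 2 by field.
      by rewrite {1}sE -lxE x12E; field.
    by rpred_auto.
  have lE' : l^-1 = p%:R * ((y1 - y2) / p%:R * g^-1 * (1 + p%:R * f)^-1).
    have -> : l^-1 = (y1 - y2) / (l * (y1 - y2)).
      by move: h0; rewrite mulf_eq0 => /norP[? ?]; field; apply/andP.
    by rewrite hE invfM; move: (g^-1) ((1 + p%:R * f)^-1) => v u; field.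
  split=> //; first by eexists; last exact: lE'; rpred_auto.
  exists (p%:R * x1 * ((y1 - y2) / p%:R * g^-1 * (1 + p%:R * f)^-1) ^+ 2); first by rpred_auto.
  by rewrite lE'; ring.
have x2q : x2 * l^-1 ^+ 2 = p%:R * (q - p%:R ^+ 3 * e * r ^+ 2).
  have -> : x2 = x1 - (x1 - x2) by ring.
  by rewrite mulrBl xq x12E lr; ring.
pose g := - (2%:R * q - p%:R ^+ 3 * e * r ^+ 2).
have gV : g \in V by rewrite /g; rpred_auto.
have g0 := principal_unit_neq0 pV gV; have g'V := principal_unitV valV pV gV.
have x3E' : x3 = l ^+ 2 * (1 + p%:R * g).
  have -> : 1 + p%:R * g = 1 - x1 * l^-1 ^+ 2 - x2 * l^-1 ^+ 2.
    by rewrite xq x2q /g; ring.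
  by rewrite x3E; field.
apply: (@torsion_not_near_inf _ _ (r ^+ 2 * (1 + p%:R * g)^-1) T3).
- by rewrite x3E' mulf_neq0 ?expf_neq0.
- by rpred_auto.
by rewrite x3E' invfM -exprVn lr; ring.
Qed.

(** Either [(y1 - y2) / (y1 + y2)] or its inverse is in V; replacing the second point by its
    opposite exchanges the two cases. *)
Lemma torsion_sep x1 y1 x2 y2 :
  torsion_point E (Aff x1 y1) -> torsion_point E (Aff x2 y2) -> x1 != x2 ->
  p%:R ^+ 2 / (x1 - x2) \in V.
Proof.
move=> T1 T2 x12; have d0 : x1 - x2 != 0 by rewrite subr_eq0.
have [//|] := orP (valV (p%:R ^+ 2 / (x1 - x2))).
set e := _^-1 => eV.
have eE : x1 - x2 = p%:R ^+ 2 * e by rewrite /e; field; rewrite p0 d0.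
have T2' := torsion_opp disc1_neq0 T2.
have [y12|y12] := eqVneq (y1 + y2) 0.
  case: (torsion_sep_aux (s := 0) T1 T2' x12 eV eE); rewrite ?rpred0 //.
  by rewrite opprK y12 mul0r.
have [sV|sV] := orP (valV ((y1 - y2) / (y1 + y2))).
  by case: (torsion_sep_aux T1 T2 x12 eV eE sV); field.
have [y21|y21] := eqVneq (y1 - y2) 0.
  by case: (torsion_sep_aux (s := 0) T1 T2 x12 eV eE); rewrite ?rpred0 // y21 mul0r.
by case: (torsion_sep_aux T1 T2' x12 eV eE sV); field; rewrite y12 y21.
Qed.

Lemma torsion_bound x y : torsion_point E (Aff x y) ->
  p%:R ^+ 2 * x \in V /\ p%:R ^+ 3 * y \in V.
Proof.
move=> T; have [Ep _] := T.
have xV : p%:R ^+ 2 * x \in V.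
  have [->|x0] := eqVneq x 0; first by rewrite mulr0 rpred0.
  have [//|tV] := orP (valV (p%:R ^+ 2 * x)).
  by case: (torsion_not_near_inf T x0 tV); field; rewrite p0 x0.
split=> //; apply: (val_sqrt valV).
have -> : (p%:R ^+ 3 * y) ^+ 2 = (p%:R ^+ 2 * x) ^+ 3 + p%:R ^+ 4 * A * (p%:R ^+ 2 * x)
  + p%:R ^+ 6 * B.
  by rewrite exprMn (proj1 (on_short_curve _ _ _ _) Ep); ring.
by rpred_auto.
Qed.

End TorsionSeparation.

(** * Progressions on a model with good reduction *)

Lemma size_le_fibers (I T : eqType) (g : I -> T) (t : seq T) (s : seq I) :
  {in s, forall i, g i \in t} -> (forall v, (count (fun i => g i == v) s <= 2)%N) ->
  (size s <= 2 * size t)%N.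
Proof.
elim: t s => [|v t IH] s st sv.
  by case: s st {sv} => // i s /(_ i); rewrite in_nil mem_head => /(_ isT).
rewrite -(count_predC (fun i => g i == v)) mulnS leq_add // -size_filter.
apply: IH => [i|w].
  by rewrite mem_filter /= => /andP[/negPf gi /st]; rewrite in_cons gi.
rewrite count_filter; apply: leq_trans (sv w).
by apply: sub_count => i /= /andP[].
Qed.

Section Interpolation.

Variables (F : numFieldType) (V : subringClosed F) (p : nat) (A B : F).
Hypothesis valV : forall x, (x \in V) || (x^-1 \in V).
Hypothesis pV : p%:R^-1 \notin V.

Let p0 : p%:R != 0 :> F := char_neq0 pV.

(** Divided differences: each division costs [p^2]. Thus [g3] is in p^(9-6) V, and [g2] is a second
    difference in p^(9-4) V minus [g3 (x0 + x1 + x2)], which is in p^(3-2) V. The exponent 9 leaves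
    one factor [p]. *)
Lemma cubic_top_coefs_small (g3 g2 g1 g0 x0 x1 x2 x3 : F)
    (G := fun x => g3 * x ^+ 3 + g2 * x ^+ 2 + g1 * x + g0) :
  uniq [:: x0; x1; x2; x3] ->
  {in [:: x0; x1; x2; x3], forall x, p%:R ^+ 2 * x \in V} ->
  {in [:: x0; x1; x2; x3] &, forall x y, x != y -> p%:R ^+ 2 / (x - y) \in V} ->
  {in [:: x0; x1; x2; x3], forall x, exists2 h, h \in V & G x = p%:R ^+ 9 * h} ->
  (exists2 t, t \in V & g3 = p%:R * t) /\ (exists2 t, t \in V & g2 = p%:R * t).
Proof.
rewrite /= !inE !negb_or => /and4P[/and3P[x01 x02 x03] /andP[x12 x13] x23 _] xV dV GV.
have [m0 m1 m2 m3] : [/\ x0 \in [:: x0; x1; x2; x3], x1 \in [:: x0; x1; x2; x3],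
  x2 \in [:: x0; x1; x2; x3] & x3 \in [:: x0; x1; x2; x3]] by rewrite !inE !eqxx !orbT.
have [h0 V0 G0] := GV _ m0; have [h1 V1 G1] := GV _ m1.
have [h2 V2 G2] := GV _ m2; have [h3 V3 G3] := GV _ m3.
have t0 := xV _ m0; have t1 := xV _ m1; have t2 := xV _ m2.
have d01 := dV _ _ m0 m1 x01; have d02 := dV _ _ m0 m2 x02; have d03 := dV _ _ m0 m3 x03.
have d12 := dV _ _ m1 m2 x12; have d13 := dV _ _ m1 m3 x13; have d23 := dV _ _ m2 m3 x23.
have ne x y : x != y -> x - y != 0 by rewrite subr_eq0.
move/ne: x01 => x01; move/ne: x02 => x02; move/ne: x03 => x03.
move/ne: x12 => x12; move/ne: x13 => x13; move/ne: x23 => x23.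
pose d (x y : F) := p%:R ^+ 2 / (x - y).
pose q := h0 * d x0 x1 * d x0 x2 * d x0 x3 - h1 * d x0 x1 * d x1 x2 * d x1 x3
  + h2 * d x0 x2 * d x1 x2 * d x2 x3 - h3 * d x0 x3 * d x1 x3 * d x2 x3.
have qV : q \in V by rewrite /q /d; rpred_auto.
have g3E : g3 = p%:R ^+ 3 * q.
  have -> : g3 = G x0 / ((x0 - x1) * (x0 - x2) * (x0 - x3))
      - G x1 / ((x0 - x1) * (x1 - x2) * (x1 - x3))
      + G x2 / ((x0 - x2) * (x1 - x2) * (x2 - x3))
      - G x3 / ((x0 - x3) * (x1 - x3) * (x2 - x3)).
    by rewrite /G; field; rewrite x01 x02 x03 x12 x13 x23.
  by rewrite G0 G1 G2 G3 /q /d; field; rewrite x01 x02 x03 x12 x13 x23.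
split; first by exists (p%:R ^+ 2 * q); [rpred_auto|rewrite g3E; ring].
pose r := h0 * d x0 x1 * d x0 x2 - h1 * d x0 x1 * d x1 x2 + h2 * d x0 x2 * d x1 x2.
have rV : r \in V by rewrite /r /d; rpred_auto.
exists (p%:R ^+ 4 * r - q * (p%:R ^+ 2 * x0 + p%:R ^+ 2 * x1 + p%:R ^+ 2 * x2)).
  by rpred_auto.
have -> : g2 = G x0 / ((x0 - x1) * (x0 - x2)) - G x1 / ((x0 - x1) * (x1 - x2))
    + G x2 / ((x0 - x2) * (x1 - x2)) - g3 * (x0 + x1 + x2).
  by rewrite /G; field; rewrite x01 x02 x12.
by rewrite G0 G1 G2 g3E /r /d; field; rewrite x01 x02 x12.
Qed.

Hypothesis p_prime : prime p.
Hypothesis p_gt2 : (2 < p)%N.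
Hypotheses (AV : A \in V) (BV : B \in V).
Hypothesis disc1 : 4%:R * A ^+ 3 + 27%:R * B ^+ 2 = 1.
Local Notation E := (Weierstrass 0 0 0 A B).

(* Eliminating [y] from [al y + be x = c] and the equation of the curve leaves a cubic in [x]
   with top coefficients [al^2] and [- be^2]. Terms whose indices are congruent modulo [p^15]
   have nearly the same [c], so their abscissas are near-roots of one such cubic. *)
Lemma primitive_AP_bound al be a b n : al \in V -> be \in V ->
  (al != 0) && (al^-1 \in V) || (be != 0) && (be^-1 \in V) -> b != 0 ->
  (forall j, (1 <= j <= n)%N -> exists x y,
     torsion_point E (Aff x y) /\ al * y + be * x = a + j%:R * b) ->
  (n <= 6 * p ^ 15)%N.
Proof.
move=> alV beV unit b0 AP; rewrite leqNgt; apply/negP => n_big.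
have p15 : (0 < p ^ 15)%N by rewrite expn_gt0 prime_gt0.
have valueV x y : torsion_point E (Aff x y) -> p%:R ^+ 3 * (al * y + be * x) \in V.
  move=> /(torsion_bound valV pV p_prime AV BV disc1) [xV yV].
  have -> : p%:R ^+ 3 * (al * y + be * x) =
    al * (p%:R ^+ 3 * y) + be * p%:R * (p%:R ^+ 2 * x) by ring.
  by rpred_auto.
pose c := a + b.
have cV : p%:R ^+ 3 * c \in V.
  have [|x [y [T xyE]]] := AP 1%N; first by rewrite (leq_ltn_trans (leq0n _) n_big).
  by have := valueV _ _ T; rewrite xyE /c mul1r.
have bV : p%:R ^+ 3 * b \in V.
  have [|x [y [T xyE]]] := AP 2%N.
    by rewrite /= (leq_trans _ n_big) // ltnS (leq_trans p15) // leq_pmull.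
  have -> : p%:R ^+ 3 * b = p%:R ^+ 3 * (a + 2%:R * b) - p%:R ^+ 3 * c by rewrite /c; ring.
  by have := valueV _ _ T; rewrite xyE => ?; rpred_auto.
pose val_at (i : nat) := c + i%:R * p%:R ^+ 15 * b.
(* The seven indices [1 + i p^15] with [i <= 6] fit because [n > 6 p^15]. *)
have [|f fP] := @fin_all_exists 'I_7 (fun=> (F * F)%type) (fun i u =>
    torsion_point E (Aff u.1 u.2) /\ al * u.2 + be * u.1 = val_at i).
  move=> i.
  have [|x [y [T xyE]]] := AP (1 + i * p ^ 15)%N.
    by rewrite /= add1n (leq_ltn_trans _ n_big) // leq_mul2r -ltnS ltn_ord orbT.
  by exists (x, y); split=> //=; rewrite xyE /val_at /c natrD natrM natrX; ring.
have val_inj : injective (fun i : 'I_7 => val_at i).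
  move=> i j /addrI /(mulIf b0) /mulIf.
  by rewrite expf_neq0 // => /(_ isT) /eqP; rewrite eqr_nat => /eqP /val_inj.
have eq_pt i j : (f i).1 = (f j).1 -> (f i).2 = (f j).2 -> i = j.
  move=> x12 y12; apply: val_inj.
  by rewrite -(proj2 (fP i)) -(proj2 (fP j)) x12 y12.
have y_pm i j : (f i).1 = (f j).1 -> i = j \/ (f i).2 = - (f j).2.
  move=> x12; have [[/on_short_curve ei _] _] := fP i; have [[/on_short_curve ej _] _] := fP j.
  have /eqP : (f i).2 ^+ 2 = (f j).2 ^+ 2 by rewrite ei ej x12.
  by rewrite eqf_sqr => /orP[] /eqP y12; [left; apply: eq_pt|right].
pose t := undup [seq (f i).1 | i <- enum 'I_7].
(* An abscissa determines [y] up to sign, so each occurs at most twice and seven points have at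
   least four abscissas. *)
have : (size (enum 'I_7) <= 2 * size t)%N.
  apply: (@size_le_fibers _ _ (fun i => (f i).1)) => [i iI|v].
    by rewrite mem_undup; apply: map_f.
  rewrite -size_filter.
  have := filter_uniq (fun i => (f i).1 == v) (enum_uniq 'I_7).
  have := filter_all (fun i => (f i).1 == v) (enum 'I_7).
  case: (filter _ _) => [|i [|j [|k r]]] //= /and4P[/eqP fi /eqP fj /eqP fk _].
  rewrite !inE !negb_or => /and4P[/and3P[/eqP ij /eqP ik _] /andP[/eqP jk _] _ _].
  have yj : (f i).2 = - (f j).2 by case: (y_pm i j) => //; rewrite fi fj.
  have yk : (f i).2 = - (f k).2 by case: (y_pm i k) => //; rewrite fi fk.
  by case: jk; apply: eq_pt; [rewrite fj|apply: oppr_inj; rewrite -yj].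
rewrite size_enum_ord.
have tP x : x \in t -> exists i, x = (f i).1.
  by rewrite mem_undup => /mapP[i _ ->]; exists i.
have : uniq t by apply: undup_uniq.
case: t tP => [|x0 [|x1 [|x2 [|x3 t]]]] // tP; set l := [:: x0; x1; x2; x3].
rewrite -[x0 :: _]/(l ++ t) cat_uniq => /andP[l_uniq _] _.
have {tP} lP x : x \in l -> exists i, x = (f i).1.
  by move=> xl; apply: tP; rewrite -[x0 :: _]/(l ++ t) mem_cat xl.
have [|||[u uV alE] [w wV beE]] := @cubic_top_coefs_small (al ^+ 2) (- be ^+ 2)
  (A * al ^+ 2 + 2%:R * c * be) (al ^+ 2 * B - c ^+ 2) _ _ _ _ l_uniq.
- move=> _ /lP[i ->]; have [T _] := fP i.
  by have [] := torsion_bound valV pV p_prime AV BV disc1 T.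
- move=> _ _ /lP[i ->] /lP[j ->]; have [Ti _] := fP i; have [Tj _] := fP j.
  exact: (torsion_sep valV pV p_prime p_gt2 AV BV disc1 Ti Tj).
- move=> _ /lP[i ->]; have [T xyE] := fP i; have [/on_short_curve e _] := T.
  have [xV _] := torsion_bound valV pV p_prime AV BV disc1 T.
  have := valueV _ _ T; rewrite xyE => vV.
  (* With [v = val_at i] the cubic equals [(v - c) (v + c - 2 be x)]. Of [p^15], three powers clear
     [b] and three clear the second factor, leaving [p^9]. *)
  exists (i%:R * (p%:R ^+ 3 * b) * (p%:R ^+ 3 * val_at i + p%:R ^+ 3 * c
    - 2%:R * be * p%:R * (p%:R ^+ 2 * (f i).1))); first by rpred_auto.
  have -> : al ^+ 2 * (f i).1 ^+ 3 + - be ^+ 2 * (f i).1 ^+ 2 +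
      (A * al ^+ 2 + 2%:R * c * be) * (f i).1 + (al ^+ 2 * B - c ^+ 2) =
      (al * (f i).2) ^+ 2 - (c - be * (f i).1) ^+ 2 by rewrite exprMn e; ring.
  have -> : al * (f i).2 = val_at i - be * (f i).1 by rewrite -xyE; ring.
  by rewrite /val_at; ring.
have not_unit x v : x != 0 -> x^-1 \in V -> v \in V -> x ^+ 2 <> p%:R * v.
  move=> x0' xV vV xE.
  have : 1 + p%:R * (- (v * x^-1 ^+ 2)) != 0 by apply: (principal_unit_neq0 pV); rpred_auto.
  by rewrite mulrN mulrA -xE -exprMn mulfV // expr1n subrr eqxx.
case/orP: unit => /andP[]; first by move=> al0 al'V; apply: not_unit alE.
move=> be0 be'V; apply: (not_unit _ (- w) be0 be'V); first by rpred_auto.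
by rewrite mulrN -beE opprK.
Qed.

(** Dividing by the p-adically larger of [al] and [be] makes one coefficient 1 and keeps the other
    in V. *)
Lemma AP_bound al be a b n : (al != 0) || (be != 0) -> b != 0 ->
  (forall j, (1 <= j <= n)%N -> exists x y,
     torsion_point E (Aff x y) /\ al * y + be * x = a + j%:R * b) ->
  (n <= 6 * p ^ 15)%N.
Proof.
move=> nz b0 AP.
suff scaled s : s != 0 -> al / s \in V -> be / s \in V ->
    (al / s != 0) && ((al / s)^-1 \in V) || (be / s != 0) && ((be / s)^-1 \in V) ->
    (n <= 6 * p ^ 15)%N.
  have [al0|al0] := eqVneq al 0.
    have be0 : be != 0 by move: nz; rewrite al0 eqxx.
    by apply: (scaled be); rewrite ?al0 ?mul0r ?rpred0 ?divff ?invr1 ?rpred1 ?oner_neq0 ?orbT.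
  have [beV|beV] := orP (valV (be / al)).
    by apply: (scaled al); rewrite ?divff ?invr1 ?rpred1 ?oner_neq0.
  have [be0|be0] := eqVneq be 0.
    by apply: (scaled al); rewrite ?be0 ?mul0r ?rpred0 ?divff ?invr1 ?rpred1 ?oner_neq0.
  rewrite invf_div in beV.
  by apply: (scaled be); rewrite ?divff ?invr1 ?rpred1 ?oner_neq0 ?orbT.
move=> s0 alV beV unit.
apply: (@primitive_AP_bound (al / s) (be / s) (a / s) (b / s)) => //.
  by rewrite mulf_neq0 ?invr_eq0.
move=> j /AP[x [y [T xyE]]]; exists x, y; split=> //.
have -> : al / s * y + be / s * x = (al * y + be * x) / s by ring.
by rewrite xyE; ring.
Qed.

End Interpolation.

(** * Reduction to such a model *)

Section ShortForm.

Variables (F : numFieldType) (E : weierstrass F) (k : F).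
Hypothesis k0 : k != 0.

Definition c6 : F := - b2 E ^+ 3 + 36%:R * b2 E * b4 E - 216%:R * b6 E.
(** Completing the square and the cube, followed by scaling [(x, y)] by [(k^2, k^3)]. *)
Definition short_A : F := - c4 E / 48%:R * k ^+ 4.
Definition short_B : F := - c6 / 864%:R * k ^+ 6.
Local Notation E' := (Weierstrass 0 0 0 short_A short_B).

Definition short_x (x : F) := k ^+ 2 * (x + b2 E / 12%:R).
Definition short_y (x y : F) := k ^+ 3 * (y + (Defs.coef1 E * x + coef3 E) / 2%:R).
Definition short_point (P : point F) :=
  if P is Aff x y then Aff (short_x x) (short_y x y) else Inf F.

Lemma short_disc : 4%:R * short_A ^+ 3 + 27%:R * short_B ^+ 2 = - disc E / 16%:R * k ^+ 12.
Proof.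
have c46 : c4 E ^+ 3 - c6 ^+ 2 = 1728%:R * disc E.
  by rewrite /disc /c6 /c4 /b8 /b2 /b4 /b6; ring.
have -> : disc E = (c4 E ^+ 3 - c6 ^+ 2) / 1728%:R by rewrite c46; field.
by rewrite /short_A /short_B; field.
Qed.

Lemma short_A_cube : k ^+ 12 = - 16%:R / disc E -> disc E != 0 ->
  short_A ^+ 3 = j_invariant E * (2%:R^-1 ^+ 8 * 3%:R^-1 ^+ 3).
Proof.
move=> kE D0; have -> : short_A ^+ 3 = - (c4 E ^+ 3 / 48%:R ^+ 3) * k ^+ 12.
  by rewrite /short_A; field.
by rewrite kE /j_invariant; field.
Qed.

Lemma on_curve_short P : on_curve E P -> on_curve E' (short_point P).
Proof.
case: P => // x y e; apply/on_short_curve; rewrite /= in e; apply: (eq_of_subM (k := k ^+ 6) e).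
by rewrite /short_x /short_y /short_A /short_B /c6 /c4 /b2 /b4 /b6; field.
Qed.

Lemma on_curve_of_short P : on_curve E' (short_point P) -> on_curve E P.
Proof.
case: P => // x y /on_short_curve e; rewrite /on_curve; apply: (eq_of_subM (k := k ^- 6) e).
by rewrite /short_x /short_y /short_A /short_B /c6 /c4 /b2 /b4 /b6; field.
Qed.

Lemma short_add P Q : on_curve E P -> on_curve E Q ->
  short_point (add_point E P Q) = add_point E' (short_point P) (short_point Q).
Proof.
case: P Q => [|x1 y1] [|x2 y2] // E1 E2.
(* Chord and tangent slopes transform by the same rule, so both cases reduce to it. *)
have slope l l' (x := l ^+ 2 + Defs.coef1 E * l - coef2 E - x1 - x2)
    (x' := l' ^+ 2 + 0 * l' - 0 - short_x x1 - short_x x2) :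
  l' = k * (l + Defs.coef1 E / 2%:R) ->
  Aff (short_x x) (short_y x (- (l + Defs.coef1 E) * x - (y1 - l * x1) - coef3 E)) =
  Aff x' (- (l' + 0) * x' - (short_y x1 y1 - l' * short_x x1) - 0).
  move=> l'E; have xE : short_x x = x'.
    by rewrite /x' l'E /x /short_x /b2; field.
  by rewrite -xE l'E /short_x /short_y; congr Aff; field.
have k20 : k ^+ 2 != 0 by rewrite expf_neq0.
have xE : (short_x x1 == short_x x2) = (x1 == x2).
  by rewrite /short_x (inj_eq (mulfI k20)) (inj_eq (addIr _)).
rewrite /short_point /add_point xE; have [x12|x12] := eqVneq x1 x2; last first.
  have d0 : x2 - x1 != 0 by rewrite subr_eq0 eq_sym.
  apply: slope.
  have -> : short_x x2 - short_x x1 = k ^+ 2 * (x2 - x1) by rewrite /short_x; ring.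
  by rewrite /short_y; field; rewrite d0.
have yE : (short_y x1 y1 + short_y x2 y2 + 0 * short_x x2 + 0 == 0) =
    (y1 + y2 + Defs.coef1 E * x2 + coef3 E == 0).
  have -> : short_y x1 y1 + short_y x2 y2 + 0 * short_x x2 + 0 =
    k ^+ 3 * (y1 + y2 + Defs.coef1 E * x2 + coef3 E) by rewrite /short_y x12; field.
  by rewrite mulf_eq0 expf_eq0 (negPf k0) andbF.
rewrite yE; have [//|y12] := eqVneq (y1 + y2 + Defs.coef1 E * x2 + coef3 E) 0.
have y21 : y2 = y1.
  rewrite /on_curve x12 in E1 E2.
  apply: (mulIf y12); apply: (eq_of_subM (k := 1) (etrans E2 (esym E1))); ring.
have d0 : 2%:R * y1 + Defs.coef1 E * x1 + coef3 E != 0.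
  by apply: contra y12 => /eqP d0; apply/eqP; rewrite y21 -x12 -[RHS]d0; ring.
apply: slope.
have -> : 2%:R * short_y x1 y1 + 0 * short_x x1 + 0 =
    k ^+ 3 * (2%:R * y1 + Defs.coef1 E * x1 + coef3 E) by rewrite /short_y; field.
have -> : 3%:R * short_x x1 ^+ 2 + 2%:R * 0 * short_x x1 + short_A - 0 * short_y x1 y1 =
    k ^+ 4 * (3%:R * x1 ^+ 2 + b2 E * x1 / 2%:R + b4 E / 2%:R).
  by rewrite /short_x /short_A /c4; field.
by rewrite /b2 /b4; field; rewrite d0.
Qed.

Lemma short_mul n P : on_curve E P ->
  short_point (mul_point E n P) = mul_point E' n (short_point P).
Proof.
move=> Ep; suff [] : on_curve E (mul_point E n P) /\
  short_point (mul_point E n P) = mul_point E' n (short_point P) by [].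
elim: n => [//|n [En nE]]; split.
  apply: on_curve_of_short; rewrite /= short_add // nE.
  by apply: on_curve_add; [|apply: on_curve_mul]; apply: on_curve_short.
by rewrite /= short_add // nE.
Qed.

Lemma short_torsion P : torsion_point E P -> torsion_point E' (short_point P).
Proof.
move=> [Ep [n [n0 nP]]]; split; first exact: on_curve_short.
by exists n; rewrite -short_mul // nP.
Qed.

End ShortForm.

(** A twelfth root normalizes the discriminant expression to 1. Then [A^3] is [j] up to powers of 2
    and 3, units of V since [p > 3], and [27 B^2 = 1 - 4 A^3] handles [B]. *)
Lemma unit_disc_model (V : subringClosed algC) (p : nat) (E : weierstrass algC) :
  (forall x, (x \in V) || (x^-1 \in V)) -> p%:R^-1 \notin V -> prime p -> (3 < p)%N ->
  elliptic E -> j_invariant E \in V ->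
  exists k, [/\ k != 0, short_A E k \in V, short_B E k \in V &
    4%:R * short_A E k ^+ 3 + 27%:R * short_B E k ^+ 2 = 1].
Proof.
move=> valV pV p_pr p_gt3 ell jV.
have D0 : - (16%:R : algC) / disc E != 0.
  by rewrite mulf_neq0 ?invr_eq0 // oppr_eq0 pnatr_eq0.
have [k kE] : exists k, k ^+ 12 = - 16%:R / disc E.
  by exists (12.-root (- 16%:R / disc E)); rewrite rootCK.
have k0 : k != 0 by apply: contraNneq D0 => k0; rewrite -kE k0 expr0n.
have discE : 4%:R * short_A E k ^+ 3 + 27%:R * short_B E k ^+ 2 = 1.
  by rewrite short_disc kE; field.
have inv_of q : prime q -> (q < p)%N -> q%:R^-1 \in V.
  move=> q_pr ltqp; apply: (coprime_invV valV pV); first exact: prime_gt0.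
  by rewrite prime_coprime // dvdn_prime2 // neq_ltn ltqp.
have V2 := inv_of 2%N isT (ltn_trans (isT : 2 < 3)%N p_gt3).
have V3 := inv_of 3%N isT p_gt3.
have AV : short_A E k \in V.
  apply: (val_cubert valV).
  rewrite (short_A_cube kE ell).
  by rpred_auto.
exists k; split=> //; apply: (val_sqrt valV).
have -> : short_B E k ^+ 2 = (1 - 4%:R * short_A E k ^+ 3) * 3%:R^-1 ^+ 3.
  by apply: (eq_of_subM (k := 27%:R^-1) discE); field.
by rpred_auto.
Qed.

Lemma torsion_AP_bound (E : weierstrass algC) (p n : nat) (q : {poly int}) : elliptic E ->
  prime p -> (3 < p)%N -> ~~ (p %| `|lead_coef q|)%N -> root (map_poly intr q) (j_invariant E) ->
  has_AP (torsion_x E) n \/ has_AP (torsion_y E) n -> (n <= 6 * p ^ 15)%N.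
Proof.
move=> ell p_pr p_gt3 pNl qj.
have [V [valV pV]] := @valuation_ring_exists algC _ p_pr.
have jV := int_root_val valV pV p_pr pNl qj.
have [k [k0 AV BV disc1]] := unit_disc_model valV pV p_pr p_gt3 ell jV.
have bound := AP_bound valV pV p_pr (ltnW p_gt3) AV BV disc1.
case=> [] [a [b [b0 AP]]].
  (* In the new coordinates X, Y: [k^-2 X = x + b2 / 12]. *)
  apply: (bound 0 (k ^- 2) (a + b2 E / 12%:R) b) => //.
    by rewrite invr_eq0 expf_neq0 ?orbT.
  move=> j /AP[y /(short_torsion k0) T]; do 2!eexists; split; first exact: T.
  by rewrite /short_x; field.
(* Here [k^-3 Y - (a1 / 2) k^-2 X] is [y] plus a constant. *)
apply: (bound (k ^- 3) (- Defs.coef1 E / 2%:R * k ^- 2)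
   (a + coef3 E / 2%:R - Defs.coef1 E / 2%:R * (b2 E / 12%:R)) b) => //.
  by rewrite invr_eq0 expf_neq0.
move=> j /AP[x /(short_torsion k0) T]; do 2!eexists; split; first exact: T.
by rewrite /short_x /short_y; field.
Qed.

(** * The computable bound *)

Lemma recursive_ext n (h h' : n.-tuple nat -> nat) : recursive h -> h =1 h' -> recursive h'.
Proof. by move=> rec_h hh'; have <- : h = h' by apply: boolp.funext. Qed.

(** Projections written with [nth] let the recursion equations of the instances below hold by
    computation. *)
Lemma recursive_nth n i : (i < n)%N -> recursive (fun v : n.-tuple nat => nth 0%N v i).
Proof. by move=> lt_in; apply: (@rec_proj _ (Ordinal lt_in)) => v; rewrite (tnth_nth 0%N). Qed.

Lemma recursive_comp1 n (f : nat -> nat) (g : n.-tuple nat -> nat) :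
  recursive (fun v : 1.-tuple nat => f (nth 0%N v 0)) -> recursive g ->
  recursive (fun v => f (g v)).
Proof.
move=> rec_f rec_g; apply: (rec_comp (g := fun=> g) rec_f) => // v.
by rewrite -(tnth_nth _ _ ord0) tnth_mktuple.
Qed.

Lemma recursive_comp2 n (f : nat -> nat -> nat) (g1 g2 : n.-tuple nat -> nat) :
  recursive (fun v : 2.-tuple nat => f (nth 0%N v 0) (nth 0%N v 1)) ->
  recursive g1 -> recursive g2 -> recursive (fun v => f (g1 v) (g2 v)).
Proof.
move=> rec_f rec_g1 rec_g2.
apply: (rec_comp (g := fun i : 'I_2 => if i == ord0 then g1 else g2) rec_f) => [i|v].
  by case: ifP.
by rewrite -(tnth_nth _ _ ord0) -(tnth_nth _ _ (Ordinal (isT : 1 < 2)%N)) !tnth_mktuple.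
Qed.

Lemma recursive_succ n (g : n.-tuple nat -> nat) : recursive g -> recursive (fun v => (g v).+1).
Proof.
by apply: recursive_comp1; apply: rec_succ => v; rewrite /thead (tnth_nth 0%N).
Qed.

Lemma recursive_const n c : recursive (fun _ : n.-tuple nat => c).
Proof. by elim: c => [|c IH]; [apply: rec_zero|apply: recursive_succ]. Qed.

Lemma recursive_add n (g1 g2 : n.-tuple nat -> nat) :
  recursive g1 -> recursive g2 -> recursive (fun v => (g1 v + g2 v)%N).
Proof.
apply: (recursive_comp2 (f := addn)).
apply: (@rec_primrec 1 (fun v => nth 0%N v 0) (fun v => (nth 0%N v 1).+1)) => //.
- exact: recursive_nth.
- by apply: recursive_succ; apply: recursive_nth.
Qed.

Lemma recursive_mul n (g1 g2 : n.-tuple nat -> nat) :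
  recursive g1 -> recursive g2 -> recursive (fun v => (g1 v * g2 v)%N).
Proof.
apply: (recursive_comp2 (f := muln)).
apply: (@rec_primrec 1 (fun=> 0%N) (fun v => (nth 0%N v 2 + nth 0%N v 1)%N)) => //.
- exact: recursive_const.
- by apply: recursive_add; apply: recursive_nth.
Qed.

Lemma recursive_exp n (g : n.-tuple nat -> nat) m :
  recursive g -> recursive (fun v => (g v ^ m)%N).
Proof.
move=> rec_g; elim: m => [|m IH]; first exact: (recursive_const n 1).
by apply: (recursive_ext (recursive_mul rec_g IH)) => v; rewrite expnS.
Qed.

Lemma recursive_fact n (g : n.-tuple nat -> nat) : recursive g -> recursive (fun v => (g v)`!).
Proof.
apply: (recursive_comp1 (f := factorial)).
apply: (@rec_primrec 0 (fun=> 1%N) (fun v => ((nth 0%N v 0).+1 * nth 0%N v 1)%N)) => //.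
- exact: recursive_const.
- by apply: recursive_mul; [apply: recursive_succ|]; apply: recursive_nth.
Qed.

(* [c.+4`!.+1] has a prime factor, and all its prime factors exceed [c.+4]. *)
Definition AP_length_bound (c : nat) : nat := (6 * (c.+4`!.+1) ^ 15)%N.

Lemma computable_AP_length_bound : computable AP_length_bound.
Proof.
apply: recursive_mul; first exact: recursive_const.
apply/recursive_exp/recursive_succ/recursive_fact.
do 4!apply: recursive_succ.
by apply: (recursive_ext (recursive_nth (isT : 0 < 1)%N)) => v; rewrite /thead (tnth_nth 0%N).
Qed.

Lemma torsion_AP_length (E : weierstrass algC) (q : {poly int}) (c n : nat) : elliptic E ->
  q != 0 -> root (map_poly intr q) (j_invariant E) -> (`|lead_coef q| <= c)%N ->
  has_AP (torsion_x E) n \/ has_AP (torsion_y E) n -> (n <= AP_length_bound c)%N.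
Proof.
move=> ell q0 qj le_qc AP.
pose p := pdiv (c.+4`!.+1).
have p_pr : prime p by rewrite pdiv_prime // ltnS fact_gt0.
have p_big : (c.+4 < p)%N.
  rewrite ltnNge; apply/negP => le_pc.
  have : (p %| c.+4`!.+1)%N by rewrite pdiv_dvd.
  by rewrite -addn1 dvdn_addr ?dvdn1 ?dvdn_fact ?prime_gt0 // => /eqP p1; rewrite p1 in p_pr.
have pNl : ~~ (p %| `|lead_coef q|)%N.
  rewrite gtnNdvd ?absz_gt0 ?lead_coef_eq0 // (leq_ltn_trans le_qc) //.
  by rewrite (leq_trans _ p_big) // !ltnS !leqW.
have p_gt3 : (3 < p)%N by apply: leq_trans p_big.
apply: leq_trans (torsion_AP_bound ell p_pr p_gt3 pNl qj AP) _.
by rewrite /AP_length_bound leq_mul2l leq_exp2r // pdiv_leq.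
Qed.

Lemma algebraic_int_poly (z : algC) : exists2 q : {poly int}, q != 0 & root (map_poly intr q) z.
Proof.
have [r [rE r_mon] _] := minCpolyP z; have [q [a a0 qE]] := rat_poly_scale r.
have q0 : q != 0.
  apply: contraTneq r_mon => q0; rewrite qE q0 rmorph0 scaler0.
  by rewrite monicE lead_coef0 eq_sym oner_eq0.
exists q => //; have := root_minCpoly z.
rewrite rE qE map_polyZ /= rootZ; last first.
  by rewrite fmorph_eq0 invr_eq0 intr_eq0.
by rewrite -map_poly_comp (eq_map_poly (fun i => ratr_int _ i)).
Qed.

(** Since a code dominates every entry of its sequence, the bound can use the code itself and needs
    no decoding. *)
Lemma leq_code (s : seq nat) k : k \in s -> (k <= CodeSeq.code s)%N.
Proof.
elim: s => // m s IH; rewrite in_cons => /orP[/eqP ->|/IH le_k] /=.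
  by rewrite (leq_trans (ltnW (ltn_expl m (ltnSn 1)))) // leq_pmulr.
apply: (leq_trans le_k); rewrite -[X in (X <= _)%N]mul1n leq_mul ?expn_gt0 //.
by rewrite -addnn ltnW // ltnS leq_addr.
Qed.

Lemma int_of_code_abs k : (`|int_of_code k| <= k)%N.
Proof.
have := odd_double_half k; rewrite /int_of_code.
by case: (odd k) => /=; move: (k./2) => h <-; rewrite -addnn ?add1n ?add0n ?ltnS leq_addr.
Qed.

Lemma code_int_poly c (z : algC) : is_code c z ->
  exists q : {poly int}, [/\ q != 0, root (map_poly intr q) z & (`|lead_coef q| <= c)%N].
Proof.
move=> [s [ds cE]]; case: s ds cE => [//|d [//|a [//|b cs]]] [_ p0 pz _ _] cE.
pose q := Poly [seq int_of_code k | k <- cs].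
have qE : map_poly intr q = Poly [seq (int_of_code k)%:~R | k <- cs] :> {poly algC}.
  by rewrite map_Poly -map_comp.
have q0 : q != 0 by apply: contraNneq p0 => q0; rewrite -qE q0 rmorph0.
exists q; split=> //; first by rewrite qE.
(* [Poly] only strips trailing zeros, so the leading coefficient is an entry of the list. *)
have : lead_coef q \in [seq int_of_code k | k <- cs].
  have := q0; rewrite -lead_coef_eq0 lead_coefE coef_Poly => l0.
  by apply: mem_nth; rewrite ltnNge; apply: contra l0 => le_s; rewrite nth_default.
case/mapP => k kcs ->; apply: leq_trans (int_of_code_abs k) _.
by rewrite cE leq_code // !in_cons kcs !orbT.
Qed.

Theorem theorem1p2 :
  (forall E : weierstrass algC, elliptic E ->
     ~ arbitrarily_long_APs (torsion_x E) /\
     ~ arbitrarily_long_APs (torsion_y E))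
  /\
  (exists B : nat -> nat, computable B /\
     forall (E : weierstrass algC) (c : nat),
       elliptic E -> is_code c (j_invariant E) ->
       forall n : nat,
         has_AP (torsion_x E) n \/ has_AP (torsion_y E) n -> (n <= B c)%N).
Proof.
split=> [E ell|].
  have [q q0 qj] := algebraic_int_poly (j_invariant E).
  have bound n := torsion_AP_length (n := n) ell q0 qj (leqnn _).
  split=> /(_ (AP_length_bound `|lead_coef q|).+1) [n [lt_n AP]].
    by have := bound n (or_introl AP); rewrite leqNgt lt_n.
  by have := bound n (or_intror AP); rewrite leqNgt lt_n.
exists AP_length_bound; split; first exact: computable_AP_length_bound.
move=> E c ell /code_int_poly[q [q0 qj le_qc]] n.
exact: torsion_AP_length ell q0 qj le_qc.
Qed.
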